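(* For the Attenuated Space poset $\mathcal A_q(N,M)$, the $q$-adjacency matrix $A$ is $Q$-polynomial.
   Context: Let $\mathbb F_q$ be a finite field with $q$ elements, let $N,M$ be positive integers, let $H$ be a vector space over $\mathbb F_q$ of dimension $N+M$, and fix a subspace $h\subseteq H$ of dimension $M$. Let $X$ be the set of subspaces $y\subseteq H$ with $y\cap h=0$, partially ordered by inclusion; this poset is the Attenuated Space poset $\mathcal A_q(N,M)$. For $y,z\in X$, $z$ covers $y$ when $y\subseteq z$ and $\dim z-\dim y=1$; $y,z$ are adjacent when one of them covers the other. Let $\mathrm{Mat}_X(\mathbb C)$ be the algebra of complex matrices with rows and columns indexed by $X$, acting on the standard module $V=\mathbb C^X$ by left multiplication. The $q$-adjacency matrix $A\in\mathrm{Mat}_X(\mathbb C)$ has $(y,z)$-entry $1$ if $y$ covers $z$; $q^{\dim y}$ if $z$ covers $y$; and $0$ if $y,z$ are not adjacent. For $0\le i\le N$ let $E^*_i\in\mathrm{Mat}_X(\mathbb C)$ be the diagonal matrix with $(y,y)$-entry $1$ if $\dim y=i$ and $0$ otherwise. Let $\mathbf M^*$ be the commutative subalgebra of $\mathrm{Mat}_X(\mathbb C)$ with basis $\{E^*_i\}_{i=0}^N$. Set $D=2N$; the matrix $A$ is diagonalizable with exactly $D+1$ eigenspaces in $V$. For an ordering $\{V_i\}_{i=0}^D$ of the eigenspaces of $A$, a dual adjacency matrix for this ordering is a matrix $\mathbf A^*$ that generates $\mathbf M^*$ and satisfies $\mathbf A^*V_i\subseteq V_{i-1}+V_i+V_{i+1}$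 for $0\le i\le D$, where $V_{-1}=0$ and $V_{D+1}=0$. An ordering of the eigenspaces of $A$ is called $Q$-polynomial when it has a dual adjacency matrix. The matrix $A$ is called $Q$-polynomial when there exists a $Q$-polynomial ordering of its eigenspaces. *)

(* Defs.v *)
From HB Require Import structures.
From mathcomp Require Import all_boot all_order all_algebra.
From mathcomp Require Import complex reals.

Set Implicit Arguments.
Unset Strict Implicit.
Unset Printing Implicit Defensive.

Import VectorInternalTheory GRing.Theory Num.Theory.
Local Open Scope ring_scope.

HB.instance Definition _ (F : finFieldType) (H : vectType F) :=
  [Countable of {vspace H} by <:].
HB.instance Definition _ (F : finFieldType) (H : vectType F) :=
  [Finite of {vspace H} by <:].

Section QPolynomial.
Variables (C : fieldType) (n : nat).
Implicit Types (A B : 'M[C]_n) (W : {vspace 'M[C]_n}) (U : {vspace 'cV[C]_n}).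

(* Left multiplication on column vectors, the standard module. *)
Definition mxact A : 'End('cV[C]_n) := linfun (mulmx A).

Definition is_subalg W : Prop :=
  1%:M \in W /\ (forall P Q, P \in W -> Q \in W -> P *m Q \in W).

Definition generates B W : Prop :=
  [/\ is_subalg W, B \in W
    & forall W', is_subalg W' -> B \in W' -> (W <= W')%VS].

Definition is_eigenspace A U : Prop :=
  exists2 a, passmx.leigenvalue (mxact A) a & U = passmx.leigenspace (mxact A) a.

Definition eigenspace_ordering A (D : nat)
    (V : 'I_D.+1 -> {vspace 'cV[C]_n}) : Prop :=
  injective V /\ (forall U, is_eigenspace A U <-> exists i, V i = U).

(* V_k for an integer k, with V_k = 0 outside 0..D. *)
Definition extV (D : nat) (V : 'I_D.+1 -> {vspace 'cV[C]_n}) (k : int)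
    : {vspace 'cV[C]_n} :=
  if k is Posz m then (if insub m is Some i then V i else 0%VS) else 0%VS.

Definition dual_adjacency (Mstar : {vspace 'M[C]_n}) (D : nat)
    (V : 'I_D.+1 -> {vspace 'cV[C]_n}) (Astar : 'M[C]_n) : Prop :=
  generates Astar Mstar /\
  (forall i : 'I_D.+1,
     (mxact Astar @: V i
        <= extV V (i%:Z - 1) + extV V i%:Z + extV V (i%:Z + 1))%VS).

Definition Q_polynomial_ordering A Mstar (D : nat)
    (V : 'I_D.+1 -> {vspace 'cV[C]_n}) : Prop :=
  eigenspace_ordering A V /\ (exists Astar, dual_adjacency Mstar V Astar).

Definition Q_polynomial A Mstar (D : nat) : Prop :=
  exists V : 'I_D.+1 -> {vspace 'cV[C]_n}, Q_polynomial_ordering A Mstar V.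

End QPolynomial.

Section AttenuatedSpace.
Variables (F : finFieldType) (H : vectType F) (h : {vspace H}).

Definition att_space : finType := {y : {vspace H} | (y :&: h == 0)%VS}.

Definition covers (z y : att_space) : bool :=
  (val y <= val z)%VS && (\dim (val z) == (\dim (val y)).+1).

Variable R : realType.

(* Rows and columns are indexed by X through the bijection enum_val. *)
Definition q_adj : 'M[R[i]]_#|att_space| :=
  \matrix_(a, b)
    let y : att_space := enum_val a in
    let z : att_space := enum_val b in
    if covers y z then 1
    else if covers z y then (#|F| ^ \dim (val y))%:R
    else 0.

Definition dual_idem (i : nat) : 'M[R[i]]_#|att_space| :=
  \matrix_(a, b)
    ((a == b) && (\dim (val (enum_val a : att_space)) == i))%:R.

Definition dual_alg (N : nat) : {vspace 'M[R[i]]_#|att_space|} :=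
  <<[seq dual_idem i | i <- iota 0 N.+1]>>%VS.

End AttenuatedSpace.

(* Main.v *)
Require Import Defs.
From mathcomp Require Import all_boot all_order all_algebra.
From mathcomp Require Import complex reals.
From mathcomp Require finfield.
From mathcomp Require Import ring zify.

(** Write A = R + K R^T, where R is the raising (covering) matrix and
    K = diag(q^dim). Counting subspaces gives the uniform-poset relation
      q R L L - (q+1) L R L + L L R = -(q+1) q^(N+M) L K^-1   (L = R^T),
    and this makes A and A* = K^-1 satisfy a tridiagonal relation. With
    t = sqrt q, g = t^(N+M) / (q-1) and theta_s = g (t^s - t^-s), the relation
    shows that A* maps the theta_s-eigenspace of A into the sum of the
    eigenspaces for theta_(s-2), theta_s and theta_(s+2).

    A vector w in ker L with L R w proportional to w generates a module
    spanned by the R^j w, of some dimension d + 1 with d <= N. Identifying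
    R^j w with a multiple of X^j, A acts there as a first order q-difference
    operator whose eigenvectors are explicit products of linear factors, with
    eigenvalues theta_s for s = d, d-2, ..., -d. Such w span ker L, and A is
    symmetric for the weighted form diag(q^C(dim,2)); so an eigenvector for any
    other eigenvalue would be orthogonal to ker L, whereas its component of
    least dimension lies in ker L. Lowest weight vectors with d = N and
    d = N-1 exist, so the eigenvalues are exactly the theta_s with |s| <= N,
    and the ordering N, N-2, ..., -N, N-1, N-3, ..., 1-N is Q-polynomial. *)

Set Implicit Arguments.
Unset Strict Implicit.
Unset Printing Implicit Defensive.

Import Order.TTheory GRing.Theory Num.Theory.
Local Open Scope ring_scope.

Lemma eq_of_sub_eq (R : zmodType) (a b c d : R) : a = b -> c - d = a - b -> c = d.
Proof. by move=> ->; rewrite subrr => /eqP; rewrite subr_eq0 => /eqP. Qed.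

(** * Splitting a vector into eigenvectors *)

Section EigenDecomposition.
Variables (C : fieldType) (n : nat).
Implicit Types (B : 'M[C]_n) (P T : 'cV[C]_n -> Prop).

(** Subspaces are encoded as predicates because [eigen_decomp] recurses on an existential one and
    [kerL_eigen_exists] uses a disjunction. *)
Definition lin_closed P := P 0 /\ forall a u v, P u -> P v -> P (a *: u + v).

Lemma lin_closedZ P a u : lin_closed P -> P u -> P (a *: u).
Proof. by case=> P0 PD Pu; rewrite -[_ *: _]addr0; apply: PD. Qed.

Lemma lin_closedD P u v : lin_closed P -> P u -> P v -> P (u + v).
Proof. by case=> P0 PD Pu Pv; rewrite -[u]scale1r; apply: PD. Qed.

Lemma lin_closedB P u v : lin_closed P -> P u -> P v -> P (u - v).
Proof. by case=> P0 PD Pu Pv; rewrite addrC -scaleN1r; apply: PD. Qed.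

Definition prodsub B (l : seq C) (x : 'cV[C]_n) : 'cV[C]_n :=
  foldl (fun y a => B *m y - a *: y) x l.

(* The summand on the eigenvalue [a] is [x - x'], where [x'] solves
   (B - a) x' = (B - a) x inside the sum of the other eigenspaces. *)
Lemma eigen_decomp B (l : seq C) P T (x : 'cV[C]_n) :
  uniq l -> lin_closed P -> (forall y, P y -> P (B *m y)) -> lin_closed T ->
  (forall a y, a \in l -> P y -> B *m y = a *: y -> T y) ->
  P x -> prodsub B l x = 0 -> T x.
Proof.
move=> ul lP PB; elim: l T x ul => [|a l IHl] T x /=.
  by move=> _ [T0 _] _ _ ->.
case/andP=> al ul lT TE Px px.
pose T' y := exists x', [/\ P x', T x' & B *m x' - a *: x' = y].
suff [x' [Px' Tx' Ex']] : T' (B *m x - a *: x).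
  rewrite -(subrK x' x); apply: lin_closedD => //.
  apply: (TE a); rewrite ?inE ?eqxx //; first exact: lin_closedB.
  rewrite mulmxBr; move/colP: Ex' => Ex'; apply/colP=> k.
  by have := Ex' k; rewrite !mxE => /esym/eq_of_sub_eq; apply; ring.
apply: IHl => //.
- split.
    exists 0; rewrite mulmx0 scaler0 subr0; split=> //; [by case: lP | by case: lT].
  move=> c u v [u' [Pu Tu <-]] [v' [Pv Tv <-]]; exists (c *: u' + v'); split.
  + by apply: lP.2.
  + by apply: lT.2.
  + by rewrite mulmxDr -scalemxAr scalerDr scalerBr !scalerA [a * c]mulrC opprD addrACA.
- move=> b y bl Py By.
  have ab : b - a != 0 by rewrite subr_eq0; apply: contraNneq al => <-.
  exists ((b - a)^-1 *: y); split; first exact: lin_closedZ.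
    by apply: lin_closedZ => //; apply: (TE b); rewrite ?inE ?bl ?orbT.
  by rewrite -scalemxAr By !scalerA -scalerBl [a * _]mulrC -mulrBr mulVf ?scale1r.
- by apply: lin_closedB; [| exact: PB | exact: lin_closedZ].
Qed.
End EigenDecomposition.

(** * Lowest weight modules *)

Section LowestWeight.
Variables (C : numFieldType) (n : nat) (Rm Lm : 'M[C]_n) (t gam : C).
Hypotheses (t_gt1 : 1 < t) (gam_neq0 : gam != 0).
Let Q := t ^+ 2.
Let G := gam ^+ 2.
Let g := gam / (Q - 1).
Let A := Rm + Lm.

(** The uniform relation with the weight [K] moved into [Lm = K R^T]: [relL] comes from the relation
    itself, [relR] from its transpose. *)
Hypothesis relR : forall v : 'cV[C]_n,
  Q ^+ 3 *: (Rm *m (Rm *m (Lm *m v))) - (Q * (Q + 1)) *: (Rm *m (Lm *m (Rm *m v)))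
    + Lm *m (Rm *m (Rm *m v)) = - ((Q + 1) * G) *: (Rm *m v).
Hypothesis relL : forall v : 'cV[C]_n,
  Q ^+ 3 *: (Rm *m (Lm *m (Lm *m v))) - (Q * (Q + 1)) *: (Lm *m (Rm *m (Lm *m v)))
    + Lm *m (Lm *m (Rm *m v)) = - ((Q + 1) * G) *: (Lm *m v).

Lemma t_gt0 : 0 < t. Proof. exact: lt_trans t_gt1. Qed.
Lemma t_neq0 : t != 0. Proof. exact: lt0r_neq0 t_gt0. Qed.
Lemma Q_gt1 : 1 < Q. Proof. by rewrite /Q exprn_egt1. Qed.
Lemma Q_neq0 : Q != 0. Proof. by rewrite expf_neq0 ?t_neq0. Qed.
Lemma Q1_neq0 : Q - 1 != 0. Proof. by rewrite subr_eq0 gt_eqF ?Q_gt1. Qed.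
Lemma QX_neq0 j : Q ^+ j != 0. Proof. by rewrite expf_neq0 ?Q_neq0. Qed.
Lemma QX_inj : injective (fun j => Q ^+ j).
Proof. by apply: ieexprIn; rewrite ?gt_eqF ?Q_gt1 // (lt_trans _ Q_gt1). Qed.
Lemma QX1_neq0 j : Q ^+ j.+1 - 1 != 0.
Proof. by rewrite subr_eq0 -(expr0 Q); apply/negP=> /eqP/QX_inj. Qed.
Lemma g_neq0 : g != 0. Proof. by rewrite mulf_neq0 ?invr_eq0 ?Q1_neq0. Qed.

(** Structure constants of [lower_iterR]. By [lw_eigval], [lw_xi d] is the eigenvalue of [Lm Rm] at
    the bottom of a module of dimension [d + 1]. *)
Definition lw_a j := Q ^+ j * (Q ^+ j.+1 - 1) / (Q - 1).
Definition lw_xi j := G * (1 - (Q ^+ j)^-1) / (Q - 1).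

Lemma lw_a_neq0 j : lw_a j != 0.
Proof. by rewrite !mulf_neq0 ?invr_eq0 ?Q1_neq0 ?QX1_neq0 ?QX_neq0. Qed.

Lemma lw_xi_inj : injective lw_xi.
Proof.
move=> i j /(congr1 (fun x => x * ((Q - 1) / G))); rewrite /lw_xi.
have G0 : G != 0 by rewrite expf_neq0.
rewrite !mulrA !divfK ?Q1_neq0 // ![G * _]mulrC !mulfK //.
by move/(addrI 1)/oppr_inj/invr_inj/QX_inj.
Qed.

Implicit Types (u v w : 'cV[C]_n).

(** [relR] applied to [R^j w] expresses [Lm R^(j+2) w] through [Lm R^(j+1) w] and [Lm R^j w], which
    gives a two-step induction. *)
Lemma lower_iterR w j : Lm *m w = 0 ->
  Lm *m iter j.+1 (mulmx Rm) w =
  lw_a j *: (iter j (mulmx Rm) (Lm *m (Rm *m w)) - lw_xi j *: iter j (mulmx Rm) w).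
Proof.
move=> Lw; set B := Lm *m (Rm *m w).
have a0 : lw_a 0 = 1 by rewrite /lw_a expr0 mul1r expr1 divff ?Q1_neq0.
have xi0 : lw_xi 0 = 0 by rewrite /lw_xi expr0 invr1 subrr mulr0 mul0r.
have RS i u : Rm *m iter i (mulmx Rm) u = iter i.+1 (mulmx Rm) u by [].
elim: j {-2}j (leqnn j) => [|m IHm] j.
  by rewrite leqn0 => /eqP-> /=; rewrite a0 xi0 scale1r scale0r subr0.
case: j => [|j] jm; first exact: IHm.
have e0 := Q1_neq0; have eq0 := Q_neq0; have eX := QX_neq0.
have := relR (iter j (mulmx Rm) w); rewrite !RS IHm //.
case: j jm => [|j] jm.
  rewrite [iter 0 _ w]/= Lw !mulmx0 scaler0 sub0r a0 xi0 scale1r scale0r subr0.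
  move/colP=> H; apply/colP=> k; have := H k.
  rewrite /= -/B !mxE => /eq_of_sub_eq; apply.
  by rewrite /lw_a /lw_xi; field; rewrite e0 eq0.
rewrite IHm 1?ltnW //.
rewrite -!scalemxAr !mulmxBr -!scalemxAr -!iterS => /colP H.
apply/colP=> k; have := H k; rewrite !mxE => /eq_of_sub_eq; apply.
by rewrite /lw_a /lw_xi !exprS; field; rewrite e0 eX eq0.
Qed.

Lemma iter_mulmxD (B : 'M[C]_n) j u v :
  iter j (mulmx B) (u + v) = iter j (mulmx B) u + iter j (mulmx B) v.
Proof. by elim: j => //= j ->; rewrite mulmxDr. Qed.

Lemma iter_mulmxZ (B : 'M[C]_n) j c u :
  iter j (mulmx B) (c *: u) = c *: iter j (mulmx B) u.
Proof. by elim: j => //= j ->; rewrite scalemxAr. Qed.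

Lemma iter_mulmx0 (B : 'M[C]_n) j : iter j (mulmx B) 0 = 0 :> 'cV[C]_n.
Proof. by elim: j => //= j ->; rewrite mulmx0. Qed.

(** With [Lm w = 0] a single term of [relL] survives. Hence [Lm Rm] maps the kernel of [Lm] to
    itself. *)
Lemma lower_kerL w : Lm *m w = 0 -> Lm *m (Lm *m (Rm *m w)) = 0.
Proof.
by move=> Lw; have := relL w; rewrite Lw !mulmx0 !scaler0 subr0 add0r.
Qed.

(** On the kernel of [Lm], [Lm^m Rm^m] is a nonzero multiple of the product of the factors
    [Lm Rm - lw_xi j] for [j < m]. The factor of largest index is peeled off first, hence [rev]. *)
Lemma prodsub_xi m w : Lm *m w = 0 -> iter m (mulmx Rm) w = 0 ->
  prodsub (Lm *m Rm) (rev (mkseq lw_xi m)) w = 0.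
Proof.
move=> Lw Rw; suff [c c0 Ec] : exists2 c, c != 0 &
    iter m (mulmx Lm) (iter m (mulmx Rm) w)
    = c *: prodsub (Lm *m Rm) (rev (mkseq lw_xi m)) w.
  by apply/eqP; have /eqP := Ec; rewrite Rw iter_mulmx0 eq_sym scaler_eq0 (negPf c0).
elim: m w Lw {Rw} => [|m IHm] w Lw; first by exists 1; rewrite ?oner_neq0 ?scale1r.
rewrite mkseqS rev_rcons /=.
have [|c c0 Ec] := IHm (Lm *m Rm *m w - lw_xi m *: w).
  by rewrite -mulmxA mulmxBr lower_kerL // -scalemxAr Lw scaler0 subr0.
exists (lw_a m * c); first by rewrite mulf_neq0 ?lw_a_neq0.
rewrite -iterS iterSr lower_iterR // -iter_mulmxZ -scaleN1r -iter_mulmxZ -iter_mulmxD iter_mulmxZ scaleN1r.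
by rewrite mulmxA Ec scalerA.
Qed.

(** In q-Pochhammer notation with base [Q] this is (-sX; Q)_a (sX; Q)_b. For [a + b = d] and
    [s = t^-d] these give the [d + 1] eigenvectors of a lowest weight module. *)
Definition splitp (s : C) (a b : nat) : {poly C} :=
  (\prod_(m < a) (1 + (s * Q ^+ m) *: 'X)) * (\prod_(m < b) (1 - (s * Q ^+ m) *: 'X)).

Lemma splitpSl s a b : splitp s a.+1 b = (1 + (s * Q ^+ a) *: 'X) * splitp s a b.
Proof. by rewrite /splitp big_ord_recr /= mulrAC mulrC. Qed.

Lemma splitpSr s a b : splitp s a b.+1 = (1 - (s * Q ^+ b) *: 'X) * splitp s a b.
Proof. by rewrite /splitp big_ord_recr /= mulrA mulrC. Qed.

(** The two new factors satisfy Q^b (1 + s Q^a X) + Q^a (1 - s Q^b X) = Q^a + Q^b. Iteration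
    expresses [1] through the products with [a + b = d]. *)
Lemma splitp_split s a b :
  (Q ^+ a + Q ^+ b) *: splitp s a b = Q ^+ b *: splitp s a.+1 b + Q ^+ a *: splitp s a b.+1.
Proof.
rewrite splitpSl splitpSr -!mul_polyC !polyCD !polyCM; ring.
Qed.

Lemma size_splitp s a b : (size (splitp s a b) <= (a + b).+1)%N.
Proof.
have sz c : (size (1 + c *: 'X : {poly C})%R <= 2)%N.
  rewrite (leq_trans (size_polyD _ _)) // geq_max size_polyC oner_neq0 /=.
  by rewrite (leq_trans (size_scale_leq _ _)) ?size_polyX.
elim: b => [|b IHb]; last first.
  rewrite splitpSr addnS (leq_trans (size_polyMleq _ _)) // -scaleNr.
  by have := leq_add (sz (- (s * Q ^+ b))) IHb; rewrite add2n; case: (_ + _)%N.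
rewrite addn0; elim: a => [|a IHa]; first by rewrite /splitp !big_ord0 mul1r size_poly1.
rewrite splitpSl (leq_trans (size_polyMleq _ _)) //.
by have := leq_add (sz (s * Q ^+ a)) IHa; rewrite add2n; case: (_ + _)%N.
Qed.

Lemma splitp0 s a b : (splitp s a b)`_0 = 1.
Proof.
elim: b => [|b IHb]; last first.
  by rewrite splitpSr coef0M IHb coefB coefZ coefX coefC /= mulr0 subr0 mulr1.
elim: a => [|a IHa]; first by rewrite /splitp !big_ord0 mul1r coefC.
by rewrite splitpSl coef0M IHa coefD coefZ coefX coefC /= mulr0 addr0 mulr1.
Qed.

Lemma coef_comp_scaleX (p : {poly C}) c j : (p \Po (c *: 'X))`_j = c ^+ j * p`_j.
Proof.
elim/poly_ind: p j => [|p b IHp] j; first by rewrite comp_poly0 !coef0 mulr0.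
rewrite comp_polyD comp_polyM comp_polyX comp_polyC -scalerAr !coefD coefZ !coefMX.
rewrite !coefC; case: j => [|j] /=; first by rewrite expr0 mulr0 !add0r mul1r.
by rewrite !addr0 IHp mulrA exprS.
Qed.

(** Replacing X by QX shifts each product by one factor: the lost first factors multiply to 1 - s^2
    X^2, and the gained last ones stand on the right. *)
Lemma splitp_dilate s a b :
  (1 - (s ^+ 2) *: 'X ^+ 2) * (splitp s a b \Po (Q *: 'X)) =
  (1 + (s * Q ^+ a) *: 'X) * (1 - (s * Q ^+ b) *: 'X) * splitp s a b.
Proof.
have comp_lin c : (1 + c *: 'X) \Po (Q *: 'X) = 1 + (c * Q) *: 'X.
  by rewrite comp_polyD comp_polyC comp_polyZ comp_polyX scalerA.
elim: b => [|b IHb].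
  elim: a => [|a IHa].
    by rewrite /splitp !big_ord0 mulr1 comp_polyC -!mul_polyC !expr0 mulr1 polyCM !rmorphXn /=; ring.
  rewrite !splitpSl comp_polyM comp_lin mulrCA IHa exprSr -!mul_polyC !polyCM; ring.
rewrite !splitpSr comp_polyM mulrCA IHb -scaleNr comp_lin exprSr -!mul_polyC.
by rewrite mulNr !rmorphN !rmorphM /=; ring.
Qed.

Definition theta (s : int) : C := g * (t ^ s - t ^ (- s)).

(** This is the coefficient of X^(j+1) in [splitp_dilate]. For this [s] the numbers s Q^a and s Q^b
    are inverse to each other, so the quadratic term on the right is -X^2. At [j = 0] the last
    summand is 0, so the default [0.-1 = 0] is harmless. *)
Lemma splitp_rec a b j (p := splitp (t ^+ (a + b))^-1 a b) :
  (t ^ (a%:Z - b%:Z) - t ^ (b%:Z - a%:Z)) * p`_j =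
  (Q ^+ j.+1 - 1) * p`_j.+1
  + (1 - Q ^+ j.-1 / Q ^+ (a + b)) * (if j is j'.+1 then p`_j' else 0).
Proof.
have tX i : t ^+ i != 0 by rewrite expf_neq0 ?t_neq0.
have Ea c e : (t ^+ (c + e))^-1 * Q ^+ c = t ^ (c%:Z - e%:Z).
  rewrite expfzDr ?t_neq0 // -exprnN -exprnP /Q -exprM mul2n -addnn !exprD.
  by field; rewrite !tX.
have Eab : t ^ (a%:Z - b%:Z) * t ^ (b%:Z - a%:Z) = 1.
  by rewrite -expfzDr ?t_neq0 // addrA subrK subrr expr0z.
have := splitp_dilate (t ^+ (a + b))^-1 a b.
rewrite -/p Ea -{2}[(a + b)%N]addnC Ea.
set al := t ^ _ in Eab *; set be := t ^ _ in Eab *.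
move/(congr1 (fun r : {poly C} => r`_j.+1)).
rewrite [X in X * p](_ : _ = 1 + (al - be) *: 'X - 'X ^+ 2); last first.
  have -> : 'X ^+ 2 = al%:P * be%:P * 'X ^+ 2 by rewrite -polyCM Eab mul1r.
  by rewrite -!mul_polyC polyCB; ring.
rewrite mulrBl mulrBl mulrDl !mul1r !coefB !coefD -!scalerAl !coefZ !coefXM !coefXnM.
rewrite !coef_comp_scaleX /=.
have -> : (t ^+ (a + b))^-1 ^+ 2 = (Q ^+ (a + b))^-1.
  by rewrite exprVn /Q -!exprM mulnC.
case: j => [|j] /= /esym /eq_of_sub_eq; apply; rewrite ?subSS ?subn0 /=; ring.
Qed.

Definition lw_s d j : C := (\prod_(i < j) (g * (1 - Q ^+ i / Q ^+ d)))^-1.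

Lemma lw_sS d j : (j < d)%N -> lw_s d j.+1 * (g * (1 - Q ^+ j / Q ^+ d)) = lw_s d j.
Proof.
move=> jd; rewrite /lw_s big_ord_recr invfM mulfVK //=.
rewrite mulf_neq0 ?g_neq0 // subr_eq0 eq_sym.
apply/negP=> /eqP/(congr1 (fun x => x * Q ^+ d)).
by rewrite mulfVK ?QX_neq0 // mul1r => /QX_inj e; rewrite e ltnn in jd.
Qed.

Section Module.
Variables (w : 'cV[C]_n) (x : C) (d : nat).
Hypotheses (Lw : Lm *m w = 0) (Bw : Lm *m (Rm *m w) = x *: w).
Hypotheses (Rd : iter d (mulmx Rm) w != 0) (Rd1 : iter d.+1 (mulmx Rm) w = 0).

(** [R^(d+1) w] vanishes and [R^d w] does not, so the coefficient in [lower_iterR] at [j = d] must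
    be 0. *)
Lemma lw_eigval : x = lw_xi d.
Proof.
have := lower_iterR d Lw; rewrite Rd1 mulmx0 Bw iter_mulmxZ -scalerBl.
move/esym/eqP; rewrite !scaler_eq0 (negPf (lw_a_neq0 _)) (negPf Rd) orbF /=.
by rewrite subr_eq0 => /eqP.
Qed.

Lemma lower_lw j : Lm *m iter j.+1 (mulmx Rm) w =
  (g ^+ 2 * (Q ^+ j.+1 - 1) * (1 - Q ^+ j / Q ^+ d)) *: iter j (mulmx Rm) w.
Proof.
rewrite lower_iterR // Bw iter_mulmxZ -scalerBl scalerA lw_eigval; congr (_ *: _).
rewrite /lw_a /lw_xi /g /G; field.
by rewrite Q1_neq0 !QX_neq0.
Qed.

(* Under [lw_Phi], [A] becomes the first order q-difference operator
   [f |-> g * ((X - X^-1) f(X) + (X^-1 - Q^-d X) f(Q X))]; the scaling [lw_s]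
   is chosen for that, and [splitp] solves the eigenvalue equation. *)
Definition lw_Phi (p : {poly C}) : 'cV[C]_n :=
  \sum_(j < d.+1) (p`_j * lw_s d j) *: iter j (mulmx Rm) w.

Lemma lw_PhiZ c p : lw_Phi (c *: p) = c *: lw_Phi p.
Proof.
by rewrite scaler_sumr; apply: eq_bigr => j _; rewrite coefZ scalerA mulrA.
Qed.

Lemma lw_PhiD p r : lw_Phi (p + r) = lw_Phi p + lw_Phi r.
Proof.
by rewrite -big_split; apply: eq_bigr => j _; rewrite coefD mulrDl scalerDl.
Qed.

Lemma lw_Phi1 : lw_Phi 1 = w.
Proof.
rewrite /lw_Phi big_ord_recl big1 => [|j _]; last by rewrite coef1 mul0r scale0r.
by rewrite coef1 /lw_s big_ord0 invr1 mulr1 scale1r addr0.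
Qed.

(** Applying [R^d] kills every term but the constant one and leaves [R^d w]. *)
Lemma lw_Phi_neq0 (p : {poly C}) : p`_0 = 1 -> lw_Phi p != 0.
Proof.
move=> p0; suff: iter d (mulmx Rm) (lw_Phi p) != 0.
  by apply: contraNneq => ->; rewrite iter_mulmx0.
suff -> : iter d (mulmx Rm) (lw_Phi p) = iter d (mulmx Rm) w by [].
have itS m (I : Type) (r : seq I) (f : I -> 'cV[C]_n) :
    iter m (mulmx Rm) (\sum_(i <- r) f i) = \sum_(i <- r) iter m (mulmx Rm) (f i).
  elim: m => // m IHm; rewrite !iterS IHm mulmx_sumr.
  by apply: eq_bigr.
rewrite itS big_ord_recl big1 => [|j _]; last first.
  by rewrite iter_mulmxZ -iterD lift0 addnC addSnnS iterD Rd1 iter_mulmx0 scaler0.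
by rewrite iter_mulmxZ p0 /lw_s big_ord0 invr1 mulr1 scale1r addr0.
Qed.

Lemma lw_Phi_eigen a b : (a + b)%N = d ->
  A *m lw_Phi (splitp (t ^+ d)^-1 a b) =
  theta (a%:Z - b%:Z) *: lw_Phi (splitp (t ^+ d)^-1 a b).
Proof.
move=> abd; set p := splitp _ a b.
have pd1 : p`_d.+1 = 0 by apply: nth_default; rewrite -abd size_splitp.
have rec j : theta (a%:Z - b%:Z) * p`_j = g * (Q ^+ j.+1 - 1) * p`_j.+1
    + g * (1 - Q ^+ j.-1 / Q ^+ d) * (if j is j'.+1 then p`_j' else 0).
  have := splitp_rec a b j; rewrite abd -/p => e.
  by rewrite /theta opprB -mulrA e mulrDr !mulrA.
rewrite mulmxDl scaler_sumr.
under [RHS]eq_bigr do rewrite scalerA mulrA rec mulrDl scalerDl.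
(* [Lm] yields the terms of the recurrence in the next coefficient, [Rm] those in the previous
   one. *)
rewrite big_split /= [LHS]addrC; congr (_ + _).
  rewrite mulmx_sumr big_ord_recl [RHS]big_ord_recr /= pd1 mulr0 mul0r scale0r addr0.
  rewrite -scalemxAr Lw scaler0 add0r; apply: eq_bigr => j _.
  rewrite /bump /= add1n -scalemxAr lower_lw scalerA -(lw_sS (ltn_ord j)).
  by congr (_ *: _); ring.
rewrite mulmx_sumr big_ord_recr [RHS]big_ord_recl /= -scalemxAr -iterS Rd1 scaler0 addr0.
rewrite mulr0 mul0r scale0r add0r; apply: eq_bigr => j _.
rewrite -scalemxAr /bump /= add1n -(lw_sS (ltn_ord j)).
by congr (_ *: _); ring.
Qed.

Lemma lw_eigen_exists a b : (a + b)%N = d ->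
  exists2 z : 'cV[C]_n, z != 0 & A *m z = theta (a%:Z - b%:Z) *: z.
Proof.
move=> abd; exists (lw_Phi (splitp (t ^+ d)^-1 a b)); last exact: lw_Phi_eigen.
by apply/lw_Phi_neq0/splitp0.
Qed.

(** Induction on [d - (a + b)]: [splitp_split] leads from [splitp s 0 0 = 1], which [lw_Phi] sends
    to [w], to the eigenvectors with [a + b = d]. *)
Lemma lw_eigen_span (T : 'cV[C]_n -> Prop) : lin_closed T ->
  (forall a b (y : 'cV[C]_n), (a + b)%N = d -> A *m y = theta (a%:Z - b%:Z) *: y -> T y) -> T w.
Proof.
move=> lT TE; suff H m a b : (a + b + m)%N = d -> T (lw_Phi (splitp (t ^+ d)^-1 a b)).
  by have := H d 0%N 0%N erefl; rewrite /splitp !big_ord0 mulr1 lw_Phi1.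
elim: m a b => [|m IHm] a b; first by rewrite addn0 => abd; apply: (TE a b) => //; apply: lw_Phi_eigen.
move=> abd; set p := splitp _ a b.
have Q0 : 0 < Q by apply: lt_trans Q_gt1.
have c0 : Q ^+ a + Q ^+ b != 0.
  by apply: lt0r_neq0; apply: addr_gt0; apply: exprn_gt0.
rewrite -[p](scalerK c0) splitp_split lw_PhiZ lw_PhiD !lw_PhiZ.
apply: lin_closedZ => //; apply: lin_closedD => //; apply: lin_closedZ => //; apply: IHm.
  by rewrite -abd addSn addnS.
by rewrite -abd addnS addSn addnS.
Qed.

End Module.

(** By [prodsub_xi] a product of distinct linear factors annihilates [Lm Rm] on [P], so [Lm Rm] is
    diagonalizable there. *)
Lemma kerL_decomp (N : nat) (P T : 'cV[C]_n -> Prop) w :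
  lin_closed P -> (forall y, P y -> Lm *m y = 0) ->
  (forall y, P y -> P (Lm *m (Rm *m y))) ->
  (forall y, P y -> iter N.+1 (mulmx Rm) y = 0) ->
  lin_closed T ->
  (forall y x, P y -> Lm *m (Rm *m y) = x *: y -> T y) -> P w -> T w.
Proof.
move=> lP PL PB PN lT TE Pw.
apply: (@eigen_decomp _ _ (Lm *m Rm) (rev (mkseq lw_xi N.+1)) P T) => //.
- by rewrite rev_uniq map_inj_uniq ?iota_uniq //; apply: lw_xi_inj.
- by move=> y /PB; rewrite mulmxA.
- by move=> a y _ Py; rewrite -mulmxA => /TE; apply.
- by apply: prodsub_xi; [exact: PL | exact: PN].
Qed.

Lemma raise_height (N : nat) w : w != 0 -> iter N.+1 (mulmx Rm) w = 0 ->
  exists d, [/\ (d <= N)%N, iter d (mulmx Rm) w != 0 & iter d.+1 (mulmx Rm) w = 0].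
Proof.
move=> w0 RN; have ex : exists m, iter m (mulmx Rm) w == 0 by exists N.+1; apply/eqP.
case: (ex_minnP ex) => [[|d] /eqP Rd minP]; first by rewrite /= in Rd; rewrite Rd eqxx in w0.
exists d; split=> //; first by rewrite -ltnS minP ?RN.
by apply: contraTneq (leqnn d.+1) => /eqP/minP; rewrite -ltnNge.
Qed.

Lemma kerL_eigen_span (N : nat) (T : 'cV[C]_n -> Prop) w :
  (forall y : 'cV[C]_n, iter N.+1 (mulmx Rm) y = 0) -> Lm *m w = 0 -> lin_closed T ->
  (forall a b (y : 'cV[C]_n), (a + b <= N)%N -> A *m y = theta (a%:Z - b%:Z) *: y -> T y) -> T w.
Proof.
move=> RN Lw lT TE.
apply: (@kerL_decomp N (fun y => Lm *m y = 0)) => //.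
- by split=> [|a u v Lu Lv]; rewrite ?mulmx0 // mulmxDr -scalemxAr Lu Lv scaler0 addr0.
- exact: lower_kerL.
- move=> y x Ly By; have [->|y0] := eqVneq y 0; first by case: lT.
  have [d [dN Rd Rd1]] := raise_height y0 (RN y).
  by apply: (lw_eigen_span Ly By Rd Rd1) => // a b z abd; apply: TE; rewrite abd.
Qed.

(** Some component [y] of [w] in an eigenspace of [Lm Rm] has [R^d y] nonzero; it generates a module
    of dimension exactly [d + 1], where [lw_eigen_exists] applies. *)
Lemma kerL_eigen_exists (P : 'cV[C]_n -> Prop) d w :
  lin_closed P -> (forall y, P y -> Lm *m y = 0) ->
  (forall y, P y -> P (Lm *m (Rm *m y))) ->
  (forall y, P y -> iter d.+1 (mulmx Rm) y = 0) ->
  P w -> iter d (mulmx Rm) w != 0 ->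
  forall a b, (a + b)%N = d -> exists2 y : 'cV[C]_n, y != 0 & A *m y = theta (a%:Z - b%:Z) *: y.
Proof.
move=> lP PL PB Pd Pw Rw a b abd.
pose E (y : 'cV[C]_n) := iter d (mulmx Rm) y = 0 \/
  exists2 z : 'cV[C]_n, z != 0 & A *m z = theta (a%:Z - b%:Z) *: z.
have lE : lin_closed E.
  split=> [|c u v]; first by left; rewrite iter_mulmx0.
  case=> [Eu|]; last by right. case=> [Ev|]; last by right.
  by left; rewrite iter_mulmxD iter_mulmxZ Eu Ev scaler0 addr0.
have [|/eqP|//] := @kerL_decomp d P E w lP PL PB Pd lE _ Pw; last by rewrite (negPf Rw).
move=> y x Py By; have [Ry|Ry] := eqVneq (iter d (mulmx Rm) y) 0; first by left.
by right; apply: (lw_eigen_exists (PL _ Py) By Ry (Pd _ Py)).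
Qed.

(** * Arithmetic of the eigenvalues and the tridiagonal relation *)

Lemma tz_inj : injective (exprz t).
Proof.
move=> s r e; apply/eqP; rewrite -subr_eq0.
have {e} : t ^ (s - r) = 1 by rewrite expfzDr ?t_neq0 // e -expfzDr ?t_neq0 // subrr expr0z.
have t1 m : t ^+ m.+1 != 1 by rewrite gt_eqF // exprn_egt1.
case: (s - r) => [[|m]|m] //; first by rewrite -exprnP => /eqP; rewrite (negPf (t1 m)).
by rewrite NegzE -exprnN => /eqP; rewrite invr_eq1 (negPf (t1 m)).
Qed.

(** Up to the factor [g], the difference of two values is (t^s - t^r)(1 + t^(-s-r)), whose second
    factor is positive. *)
Lemma theta_inj : injective theta.
Proof.
move=> s r /(mulfI g_neq0) e; have t0 := t_neq0; have tp := t_gt0.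
have e2 : (t ^ s - t ^ r) * (1 + t ^ (- s - r)) = 0.
  rewrite expfzDr // -!invr_expz; move: e; rewrite -!invr_expz => /eq_of_sub_eq; apply.
  by field; rewrite !expfz_neq0.
apply: tz_inj.
apply/eqP; rewrite -subr_eq0; move/eqP: e2; rewrite mulf_eq0 => /orP[//|].
by rewrite gt_eqF // addr_gt0 ?ltr01 ?exprz_gt0.
Qed.

(** The neighbours of [theta s] enter the tridiagonal relation only through their sum and product,
    both polynomial in [theta s]. *)
Lemma theta_add s :
  theta (s + 2) + theta (s - 2) = (Q + Q^-1) * theta s.
Proof.
rewrite /theta !opprD opprK !expfzDr ?t_neq0 //.
have Q1 := Q1_neq0; rewrite /Q in Q1.
by rewrite expr1z exprN1 /g /Q; field; rewrite t_neq0 Q1.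
Qed.

Lemma theta_mul s :
  theta (s + 2) * theta (s - 2) = theta s ^+ 2 - G * (Q + 1) ^+ 2 / Q ^+ 2.
Proof.
rewrite /theta !opprD opprK !expfzDr ?t_neq0 //.
have Q1 := Q1_neq0; rewrite /Q in Q1.
rewrite expr1z exprN1 -!invr_expz /g /G /Q.
have ts : t ^ s != 0 by rewrite expfz_neq0 ?t_neq0.
by field; rewrite ts t_neq0 Q1.
Qed.

(* Up to the factor [S], this is the tridiagonal relation
   [A, A^2 S - (Q + Q^-1) A S A + S A^2 - rho S] = 0 evaluated at [v];
   only the words with mixed [Rm] and [Lm] survive, and they are eliminated
   by [relR] and [relL]. *)
Lemma tridiagonal (S : 'M[C]_n) v s :
  (forall u, Rm *m (S *m u) = Q *: (S *m (Rm *m u))) ->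
  (forall u, Lm *m (S *m u) = Q^-1 *: (S *m (Lm *m u))) ->
  A *m v = theta s *: v ->
  prodsub A [:: theta s; theta (s + 2); theta (s - 2)] (S *m v) = 0.
Proof.
move=> RS LS Av.
(* Chosen so that [A S = S A1]: then [S] moves to the front, and it is enough that the vector behind
   it vanishes. *)
pose A1 u := Q *: (Rm *m u) + Q^-1 *: (Lm *m u).
have AS u : A *m (S *m u) = S *m A1 u.
  by rewrite mulmxDl RS LS mulmxDr -!scalemxAr.
have A1B u u' : A1 (u - u') = A1 u - A1 u'.
  by rewrite /A1 !mulmxBr !scalerBr opprD addrACA.
have A1Z c u : A1 (c *: u) = c *: A1 u.
  by rewrite /A1 -!scalemxAr scalerDr !scalerA ![c * _]mulrC.
have step c u : A *m (S *m u) - c *: (S *m u) = S *m (A1 u - c *: u).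
  by rewrite AS mulmxBr scalemxAr.
rewrite /prodsub /= !step; apply/eqP; rewrite (_ : A1 _ - _ = 0) ?mulmx0 //.
(* The coefficients are those of (x - 1)(x - Q)(x - 1/Q), whose roots [Q] and [1/Q] cancel the words
   [RRR] and [LLL]. *)
have Id : A1 (A1 (A1 v)) - (Q + Q^-1 + 1) *: A1 (A1 (A *m v))
    + (Q + Q^-1 + 1) *: A1 (A *m (A *m v)) - A *m (A *m (A *m v))
    = (G * (Q + 1) ^+ 2 / Q ^+ 2) *: (A1 v - A *m v).
  have HR := relR v; have HL := relL v.
  rewrite /A1 /A !mulmxDl !mulmxDr -!scalemxAr !mulmxDr -!scalemxAr.
  move: HR HL.
  move: (Rm *m (Rm *m (Rm *m v))) (Lm *m (Lm *m (Lm *m v))) => rrr lll.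
  move: (Rm *m (Rm *m (Lm *m v))) (Rm *m (Lm *m (Rm *m v))) => rrl rlr.
  move: (Lm *m (Rm *m (Rm *m v))) (Rm *m (Lm *m (Lm *m v))) => lrr rll.
  move: (Lm *m (Rm *m (Lm *m v))) (Lm *m (Lm *m (Rm *m v))) => lrl llr.
  move: (Rm *m v) (Lm *m v) => r l /colP HR /colP HL; apply/colP=> i.
  have := HL i; have := HR i; rewrite !mxE => {}HR {}HL.
  have Q0 := Q_neq0.
  (* The multipliers of the two relations are read off from the coefficients of [rrl] and [rll] in
     the expansion. *)
  have {}HR : - (Q - 1) * (Q + 1) / Q ^+ 2 * (Q ^+ 3 * rrl i 0 - (Q * (Q + 1)) * rlr i 0 + lrr i 0)
     = - (Q - 1) * (Q + 1) / Q ^+ 2 * (- ((Q + 1) * G) * r i 0) by rewrite HR.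
  have {}HL : (Q - 1) * (Q + 1) / Q ^+ 3 * (Q ^+ 3 * rll i 0 - (Q * (Q + 1)) * lrl i 0 + llr i 0)
     = (Q - 1) * (Q + 1) / Q ^+ 3 * (- ((Q + 1) * G) * l i 0) by rewrite HL.
  have {HR HL} := congr2 +%R HR HL => /eq_of_sub_eq; apply.
  field.
  by [].
move: Id; rewrite Av -!scalemxAr Av -!scalemxAr Av !(A1B, A1Z).
move: (A1 v) (A1 (A1 v)) (A1 (A1 (A1 v))) => c3 c2 c1 /colP Id.
apply/colP=> i; have := Id i; rewrite !mxE => {}Id.
have := theta_mul s; have := theta_add s.
move: Id; move: (theta (s + 2)) (theta (s - 2)) (theta s) => x y th Id.
move=> /eqP; rewrite -subr_eq0 => /eqP E1 /eqP; rewrite -subr_eq0 => /eqP E2.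
(* The goal differs from [Id] by multiples of the sum relation [E1] and the product relation [E2],
   with these multipliers. *)
have : forall z1 z2 z3 z4, z1 = 0 -> z2 = 0 -> z3 = z4 ->
    - z1 * c2 i 0 + (th * z1 + z2) * c3 i 0 - th * z2 * v i 0 + z3 = z4.
  by move=> z1 z2 z3 z4 -> -> ->; ring.
by move=> /(_ _ _ _ _ E1 E2 Id) /eq_of_sub_eq; apply; ring.
Qed.

End LowestWeight.

(** * Graded matrices and the spectrum *)

Section GradedMatrix.
Variables (C : numClosedFieldType) (n N : nat) (deg : 'I_n -> nat).
Variables (Rm : 'M[C]_n) (t gam : C).
Hypotheses (t_gt1 : 1 < t) (gam_neq0 : gam != 0).
Hypothesis deg_le : forall a, (deg a <= N)%N.
Hypothesis Rm_deg : forall a b, Rm a b != 0 -> deg a = (deg b).+1.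
Hypothesis Rm_real : forall a b, (Rm a b)^* = Rm a b.
Let Q := t ^+ 2.
Let G := gam ^+ 2.

Definition Kmx : 'M[C]_n := diag_mx (\row_a Q ^+ deg a).
(** The inverse of [Kmx], and the dual adjacency matrix of the final ordering. *)
Definition Smx : 'M[C]_n := diag_mx (\row_a (Q ^+ deg a)^-1).
Definition Lmx : 'M[C]_n := Kmx *m Rm^T.

Hypothesis uniform :
  Q *: (Rm *m Rm^T *m Rm^T) - (Q + 1) *: (Rm^T *m Rm *m Rm^T) + Rm^T *m Rm^T *m Rm
  = - ((Q + 1) * G) *: (Rm^T *m Smx).

Let Q0 : Q != 0 := Q_neq0 t_gt1.
Let A := Rm + Lmx.

Lemma Smx_raise (u : 'cV[C]_n) : Rm *m (Smx *m u) = Q *: (Smx *m (Rm *m u)).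
Proof.
rewrite !mulmxA scalemxAl; congr (_ *m _); apply/matrixP=> a b.
rewrite mul_mx_diag mxE mul_diag_mx !mxE.
have [->|/Rm_deg->] := eqVneq (Rm a b) 0; first by rewrite !(mulr0, mul0r).
by rewrite exprS; field; rewrite Q0 expf_neq0.
Qed.

Lemma Kmx_raise : Kmx *m Rm = Q *: (Rm *m Kmx).
Proof.
apply/matrixP=> a b; rewrite mul_diag_mx mxE [RHS]mxE mul_mx_diag !mxE.
have [->|/Rm_deg->] := eqVneq (Rm a b) 0; first by rewrite !(mulr0, mul0r).
by rewrite exprS; ring.
Qed.

Lemma Kmx_lower : Rm^T *m Kmx = Q *: (Kmx *m Rm^T).
Proof. by rewrite -[Kmx]tr_diag_mx -!trmx_mul Kmx_raise linearZ. Qed.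

Lemma KmxSmx : Kmx *m Smx = 1%:M.
Proof.
rewrite mulmx_diag -diag_const_mx; congr diag_mx; apply/rowP=> a.
by rewrite !mxE mulfV // expf_neq0.
Qed.

Lemma LmxE a b : Lmx a b = Q ^+ deg a * Rm b a.
Proof. by rewrite /Lmx mul_diag_mx !mxE. Qed.

Lemma SmxE p (M : 'M_(n, p)) a b : (Smx *m M) a b = (Q ^+ deg a)^-1 * M a b.
Proof. by rewrite mul_diag_mx !mxE. Qed.

Lemma Smx_lower (u : 'cV[C]_n) : Lmx *m (Smx *m u) = Q^-1 *: (Smx *m (Lmx *m u)).
Proof.
rewrite (mulmxA Lmx Smx) (mulmxA Smx Lmx) scalemxAl; congr (_ *m _); apply/matrixP=> a b.
rewrite mul_mx_diag mxE [RHS]mxE SmxE !LmxE !mxE.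
have [->|/Rm_deg->] := eqVneq (Rm b a) 0; first by rewrite !(mulr0, mul0r).
by rewrite exprS; field; rewrite Q0 expf_neq0.
Qed.

Lemma raise_Kmx p (M : 'M_(n, p)) : Rm *m (Kmx *m M) = Q^-1 *: (Kmx *m (Rm *m M)).
Proof. by rewrite !mulmxA Kmx_raise -scalemxAl scalerK. Qed.

Lemma lower_Kmx p (M : 'M_(n, p)) : Rm^T *m (Kmx *m M) = Q *: (Kmx *m (Rm^T *m M)).
Proof. by rewrite !mulmxA Kmx_lower -scalemxAl. Qed.

Lemma uniform_lower (v : 'cV[C]_n) :
  Q ^+ 3 *: (Rm *m (Lmx *m (Lmx *m v))) - (Q * (Q + 1)) *: (Lmx *m (Rm *m (Lmx *m v)))
    + Lmx *m (Lmx *m (Rm *m v)) = - ((Q + 1) * G) *: (Lmx *m v).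
Proof.
have := congr1 (fun M => Q *: (Kmx *m (Kmx *m (M *m v)))) uniform.
rewrite /Lmx !(mulmxDl, mulmxDr, mulNmx, mulmxN) -!scalemxAl -!scalemxAr -!mulmxA.
rewrite !(raise_Kmx, lower_Kmx) -?scalemxAr ?(raise_Kmx, lower_Kmx) -?scalemxAr.
have -> : Kmx *m (Kmx *m (Rm^T *m (Smx *m v))) = Q^-1 *: (Kmx *m (Rm^T *m v)).
  rewrite -[Kmx *m (Rm^T *m (Smx *m v))](scalerK Q0) -lower_Kmx.
  by rewrite (mulmxA Kmx Smx) KmxSmx mul1mx -scalemxAr.
move=> /colP e; apply/colP=> i; have := e i; rewrite !mxE => /eq_of_sub_eq; apply.
by field.
Qed.

Lemma uniform_raise (v : 'cV[C]_n) :
  Q ^+ 3 *: (Rm *m (Rm *m (Lmx *m v))) - (Q * (Q + 1)) *: (Rm *m (Lmx *m (Rm *m v)))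
    + Lmx *m (Rm *m (Rm *m v)) = - ((Q + 1) * G) *: (Rm *m v).
Proof.
have uT : Q *: (Rm *m Rm *m Rm^T) - (Q + 1) *: (Rm *m Rm^T *m Rm) + Rm^T *m Rm *m Rm
    = - ((Q + 1) * G) *: (Smx *m Rm).
  have := congr1 trmx uniform; rewrite 2!linearD linearN 2!linearZ [RHS]linearZ /=.
  by rewrite ?scalerN !trmx_mul !trmxK [Smx^T]tr_diag_mx !mulmxA.
have := congr1 (fun M => Kmx *m (M *m v)) uT; rewrite /Lmx.
rewrite !(mulmxDl, mulmxDr, mulNmx, mulmxN) -!scalemxAl -!scalemxAr ?(mulNmx, mulmxN).
rewrite -!mulmxA !(raise_Kmx, lower_Kmx) -?scalemxAr ?(raise_Kmx, lower_Kmx) -?scalemxAr.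
rewrite (mulmxA Kmx Smx) KmxSmx mul1mx.
move=> /colP e; apply/colP=> i; have := e i; rewrite !mxE => /eq_of_sub_eq; apply.
by field.
Qed.

(** Since C(k+1, 2) = C(k, 2) + k, the two weights differ exactly by the factor [Q^k] that the
    lowering entry carries. *)
Lemma Amx_sym a b : Q ^+ 'C(deg a, 2) * A a b = Q ^+ 'C(deg b, 2) * A b a.
Proof.
rewrite /A 2![(Rm + _) _ _]mxE !LmxE.
have [Rab|/Rm_deg dab] := eqVneq (Rm a b) 0; last first.
  have -> : Rm b a = 0 by apply: contra_eq (dab) => /Rm_deg ->; rewrite neq_ltn ltnS leqnSn.
  by rewrite dab binS bin1 exprD; ring.
have [Rba|/Rm_deg dba] := eqVneq (Rm b a) 0; first by rewrite Rab Rba !(mulr0, addr0).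
by rewrite Rab dba binS bin1 exprD; ring.
Qed.

Lemma iter_raise_eq0 m (y : 'cV[C]_n) i : (forall a, y a 0 != 0 -> (i <= deg a)%N) ->
  (N < i + m)%N -> iter m (mulmx Rm) y = 0.
Proof.
move=> yi Nm; suff H a : iter m (mulmx Rm) y a 0 != 0 -> (i + m <= deg a)%N.
  apply/colP=> a; rewrite mxE; apply/eqP; apply: contraTT Nm => /H.
  by rewrite -leqNgt => /leq_trans; apply.
elim: m a {Nm} => [|m IHm] a /=; first by rewrite addn0; apply: yi.
apply: contraR; rewrite mxE -ltnNge addnS ltnS => da.
rewrite big1 // => b _; have [->|/Rm_deg dab] := eqVneq (Rm a b) 0; first by rewrite mul0r.
have [->|/IHm] := eqVneq (iter m (mulmx Rm) y b 0) 0; first by rewrite mulr0.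
by move=> /(leq_trans da); rewrite dab ltnn.
Qed.

Local Notation theta := (theta t gam).

Lemma spectrum (v : 'cV[C]_n) th : v != 0 -> A *m v = th *: v ->
  exists a b : nat, (a + b <= N)%N /\ th = theta (a%:Z - b%:Z).
Proof.
move=> v0 Av.
have [a1 va1] : exists a, v a 0 != 0.
  apply/existsP; apply: contraR v0; rewrite negb_exists => /forallP v0.
  by apply/eqP/colP=> a; rewrite mxE; apply/eqP; move: (v0 a); rewrite negbK.
case: (@arg_minnP _ a1 (fun a => v a 0 != 0) deg va1) => a0 va0 mina0.
(* The conjugate makes the bilinear form in [T], evaluated at [u], a weighted sum of squared
   absolute values over the least degree [i]. *)
pose i := deg a0; pose u : 'cV[C]_n := \col_a ((v a 0)^* *+ (deg a == i)).
have vlow a : (deg a < i)%N -> v a 0 = 0.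
  by move=> da; apply: contraTeq da => /mina0; rewrite -leqNgt.
(* Only coordinates of degree [i - 1] matter. There [v] and [Rm *m v] vanish, so the eigenvalue
   equation forces [Lmx *m v] to vanish too; realness of [Rm] passes this to the conjugate. *)
have Lu : Lmx *m u = 0.
  apply/colP=> y; rewrite /Lmx -mulmxA mul_diag_mx !mxE.
  rewrite (_ : \sum_j _ = (Rm^T *m u) y 0); last by rewrite mxE.
  apply/eqP; rewrite mulf_eq0 expf_eq0 (negPf Q0) andbF /=; apply/eqP.
  have [dy|dy] := eqVneq (deg y).+1 i; last first.
    rewrite mxE big1 // => z _; rewrite !mxE.
    have [->|/Rm_deg ->] := eqVneq (Rm z y) 0; first by rewrite mul0r.
    by rewrite (negPf dy) mulr0.
  have vy0 : v y 0 = 0 by apply: vlow; rewrite -dy.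
  have Ry : (Rm *m v) y 0 = 0.
    rewrite mxE big1 // => z _.
    have [->|/Rm_deg dyz] := eqVneq (Rm y z) 0; first by rewrite mul0r.
    by rewrite vlow ?mulr0 // -dy dyz !ltnS.
  have Ly : (Rm^T *m v) y 0 = 0.
    move/colP/(_ y): Av; rewrite /A /Lmx mulmxDl mxE Ry add0r -mulmxA mul_diag_mx.
    rewrite [LHS]mxE [RHS]mxE vy0 mulr0 mxE => /eqP.
    by rewrite mulf_eq0 expf_eq0 (negPf Q0) andbF => /eqP.
  rewrite -(conjC0 C) -Ly !mxE rmorph_sum; apply: eq_bigr => z _.
  rewrite rmorphM /= !mxE Rm_real.
  have [->|/Rm_deg ->] := eqVneq (Rm z y) 0; first by rewrite !mul0r.
  by rewrite dy eqxx.
pose T (y : 'cV[C]_n) := \sum_a (v a 0 * Q ^+ 'C(deg a, 2)) * y a 0 = 0.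
have lT : lin_closed T.
  split=> [|c x y]; first by rewrite /T big1 // => a _; rewrite mxE mulr0.
  rewrite /T => Tx Ty.
  under eq_bigr do rewrite 2!mxE mulrDr mulrCA.
  by rewrite big_split -mulr_sumr /= Tx Ty mulr0 addr0.
have RN (y : 'cV[C]_n) : iter N.+1 (mulmx Rm) y = 0 by apply: (@iter_raise_eq0 _ _ 0).
case: (boolP [exists a : 'I_N.+1, [exists b : 'I_N.+1,
    (a + b <= N)%N && (th == theta (a%:Z - b%:Z))]]) => [|noth].
  by case/existsP=> a /existsP[b /andP[ab /eqP->]]; exists a, b.
have Tu : T u.
  apply: (kerL_eigen_span t_gt1 gam_neq0 uniform_raise uniform_lower RN Lu lT) => a b y abN Ay.
  have thab : th - theta (a%:Z - b%:Z) != 0.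
    rewrite subr_eq0; apply: contra noth => e.
    have aN : (a < N.+1)%N by rewrite ltnS (leq_trans _ abN) ?leq_addr.
    have bN : (b < N.+1)%N by rewrite ltnS (leq_trans _ abN) ?leq_addl.
    by apply/existsP; exists (Ordinal aN); apply/existsP; exists (Ordinal bN); rewrite abN.
  (* Eigenvectors for different eigenvalues are orthogonal, by symmetry of the weighted form. *)
  apply: (mulfI thab); rewrite mulr0 mulrBl; apply/eqP; rewrite subr_eq0; apply/eqP.
  rewrite !mulr_sumr.
  transitivity (\sum_a \sum_b Q ^+ 'C(deg a, 2) * A a b * v b 0 * y a 0).
    apply: eq_bigr => x _; move/colP/(_ x): Av; rewrite !mxE => Ax.
    by rewrite !mulrA -Ax !mulr_suml; apply: eq_bigr => z _; rewrite mxE; ring.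
  rewrite exchange_big; apply: eq_bigr => x _; move/colP/(_ x): Ay; rewrite !mxE => Ax.
  rewrite mulrCA -Ax mulr_sumr; apply: eq_bigr => z _; rewrite Amx_sym !mxE; ring.
have : \sum_a `|v a 0| ^+ 2 * Q ^+ 'C(deg a, 2) *+ (deg a == i) = 0.
  rewrite -[RHS]Tu; apply: eq_bigr => a _.
  by rewrite mxE mulrnAr normCK; congr (_ *+ _); ring.
move/psumr_eq0P => /(_ _ a0) H; have {H} : `|v a0 0| ^+ 2 * Q ^+ 'C(deg a0, 2) = 0.
  have := H _ isT; rewrite eqxx mulr1n; apply=> a _.
  have t0 : 0 <= t by rewrite ltW // (lt_trans _ t_gt1).
  by rewrite mulrn_wge0 // mulr_ge0 ?exprn_ge0.
by move/eqP; rewrite mulf_eq0 !expf_eq0 normr_eq0 (negPf va0) (negPf (t_neq0 t_gt1)) !andbF.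
Qed.

End GradedMatrix.

(** * Eigenspaces in terms of eigenvectors *)

Section Eigenspaces.
Variables (C : fieldType) (n : nat) (A : 'M[C]_n).

Lemma mem_leigenspace th (v : 'cV[C]_n) :
  (v \in passmx.leigenspace (mxact A) th) = (A *m v == th *: v).
Proof.
by rewrite memv_ker !(add_lfunE, opp_lfunE, scale_lfunE) !lfunE /= subr_eq0.
Qed.

Lemma leigenvalueP th :
  reflect (exists2 v : 'cV[C]_n, v != 0 & A *m v = th *: v)
          (passmx.leigenvalue (mxact A) th).
Proof.
apply: (iffP idP) => [|[v v0 Av]].
  rewrite /passmx.leigenvalue -vpick0 => v0; eexists; first exact: v0.
  by apply/eqP; rewrite -mem_leigenspace memv_pick.
apply: contra v0 => /eqP E0; rewrite -memv0 -E0 mem_leigenspace; exact/eqP.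
Qed.

End Eigenspaces.

(** * The algebra of matrices diagonal in the degree *)

Section GradedIdempotents.
Variables (C : fieldType) (n N : nat) (deg : 'I_n -> nat).
Hypothesis deg_le : forall a, (deg a <= N)%N.

(** For [deg] the dimension of the indexed subspace, [deg_idem] and [deg_alg] unfold to [dual_idem]
    and [dual_alg]. *)
Definition deg_idem i : 'M[C]_n := \matrix_(a, b) ((a == b) && (deg a == i))%:R.
Definition deg_alg : {vspace 'M[C]_n} := <<[seq deg_idem i | i <- iota 0 N.+1]>>%VS.
Definition deg_diag (f : nat -> C) : 'M[C]_n := diag_mx (\row_a f (deg a)).

Lemma deg_diagE f : deg_diag f = \sum_(i < N.+1) f i *: deg_idem i.
Proof.
apply/matrixP=> a b; rewrite !mxE summxE.
have dN : (deg a < N.+1)%N by rewrite ltnS.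
rewrite (bigD1 (Ordinal dN)) //= big1 => [|i ia].
  by rewrite !mxE eqxx andbT addr0 mulr_natr.
rewrite !mxE; have [e|_] := eqVneq (deg a) i; last by rewrite andbF mulr0.
by case/eqP: ia; apply: val_inj.
Qed.

Lemma deg_algP M : reflect (exists f, M = deg_diag f) (M \in deg_alg).
Proof.
apply: (iffP idP) => [|[f ->]].
  pose X := [seq deg_idem i | i <- iota 0 N.+1].
  move=> /(@coord_span _ _ _ (in_tuple X)) ->; pose c i := coord (in_tuple X) i M.
  exists (fun j => if insub j is Some i then c i else 0).
  rewrite deg_diagE.
  have sX : size X = N.+1 by rewrite size_map size_iota.
  rewrite (reindex (cast_ord sX)); last first.
    by exists (cast_ord (esym sX)) => i _; rewrite ?cast_ordK ?cast_ordKV.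
  apply: eq_bigr => i _ /=; rewrite insubT /=; first by rewrite ltn_ord.
  move=> lti; rewrite (nth_map 0%N) ?nth_iota ?add0n ?size_iota -?sX //.
  by congr (c _ *: _); apply: val_inj.
rewrite deg_diagE memv_suml // => i _; rewrite memvZ // memv_span //.
by apply: map_f; rewrite mem_iota add0n ltn_ord.
Qed.

Lemma deg_diagM f g : deg_diag f *m deg_diag g = deg_diag (fun i => f i * g i).
Proof. by rewrite mulmx_diag; congr diag_mx; apply/rowP=> a; rewrite !mxE. Qed.

Lemma deg_alg_subalg : is_subalg deg_alg.
Proof.
split=> [|P R /deg_algP[f ->] /deg_algP[g ->]].
  apply/deg_algP; exists (fun=> 1).
  by rewrite -diag_const_mx; congr diag_mx; apply/rowP=> a; rewrite !mxE.
by apply/deg_algP; exists (fun i => f i * g i); rewrite deg_diagM.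
Qed.

Lemma deg_diag_generates f :
  {in [pred i | (i <= N)%N] &, injective f} -> generates (deg_diag f) deg_alg.
Proof.
move=> f_inj; split; [exact: deg_alg_subalg | by apply/deg_algP; exists f |].
move=> W [W1 WM] Wf; apply/span_subvP=> x /mapP[j]; rewrite mem_iota add0n ltnS.
move: j => i /= iN ->{x}.
(* Lagrange interpolation at the values of [f]. *)
pose l := [seq j <- iota 0 N.+1 | j != i].
have Wl (s : seq nat) : deg_diag (fun j => \prod_(k <- s) ((f j - f k) / (f i - f k))) \in W.
  elim: s => [|k s IHs].
    rewrite (_ : deg_diag _ = 1%:M) // -diag_const_mx.
    by congr diag_mx; apply/rowP=> a; rewrite !mxE big_nil.
  rewrite (_ : deg_diag _ = ((f i - f k)^-1 *: (deg_diag f - f k *: 1%:M)) *m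
      deg_diag (fun j => \prod_(k <- s) ((f j - f k) / (f i - f k)))).
    by rewrite WM // memvZ // memvB // memvZ.
  rewrite [X in X *m _](_ : _ = deg_diag (fun j => (f j - f k) / (f i - f k))).
    rewrite deg_diagM; congr diag_mx; apply/rowP=> a; rewrite !mxE big_cons //.
  apply/matrixP=> a b; rewrite !mxE; case: eqVneq => _ /=; last by rewrite !mulr0n mulr0 subr0 mulr0.
  by rewrite !mulr1n mulr1 mulrC.
rewrite (_ : deg_idem i = deg_diag (fun j => \prod_(k <- l) ((f j - f k) / (f i - f k)))) //.
apply/matrixP=> a b; rewrite !mxE; case: eqVneq => _; last by rewrite mulr0n.
rewrite mulr1n; case: eqVneq => [->|dai] /=.
  rewrite big_seq big1 // => k; rewrite mem_filter mem_iota add0n ltnS => /andP[ki kN].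
  by rewrite divff // subr_eq0; apply: contraNneq ki => /f_inj <-.
have dl : deg a \in l by rewrite mem_filter dai mem_iota add0n ltnS deg_le.
by rewrite (big_rem _ dl) /= subrr !mul0r.
Qed.

End GradedIdempotents.

(** * The Q-polynomial ordering *)

Section GradedQPolynomial.
Variables (C : numClosedFieldType) (n N : nat) (deg : 'I_n -> nat).
Variables (Rm : 'M[C]_n) (t gam : C).
Hypotheses (t_gt1 : 1 < t) (gam_neq0 : gam != 0) (N_gt0 : (0 < N)%N).
Hypothesis deg_le : forall a, (deg a <= N)%N.
Hypothesis Rm_deg : forall a b, Rm a b != 0 -> deg a = (deg b).+1.
Hypothesis Rm_real : forall a b, (Rm a b)^* = Rm a b.
Local Notation Q := (t ^+ 2).
Local Notation S := (Smx deg t).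
Local Notation L := (Lmx deg Rm t).
Local Notation theta := (theta t gam).
Hypothesis uniform :
  Q *: (Rm *m Rm^T *m Rm^T) - (Q + 1) *: (Rm^T *m Rm *m Rm^T) + Rm^T *m Rm^T *m Rm
  = - ((Q + 1) * gam ^+ 2) *: (Rm^T *m S).
Let A := Rm + L.

(** From degree [N - d], with [d <= N], exactly [d] raising steps reach the top degree [N], so one
    step more gives 0. *)
Definition lowest d (w : 'cV[C]_n) :=
  [/\ forall a, w a 0 != 0 -> deg a = (N - d)%N, Rm^T *m w = 0
    & iter d (mulmx Rm) w != 0].

Hypothesis lowestN : exists w, lowest N w.
Hypothesis lowestN1 : exists w, lowest N.-1 w.

Lemma lowest_eigen d w a b : (d <= N)%N -> lowest d w -> (a + b)%N = d ->
  exists2 y : 'cV[C]_n, y != 0 & A *m y = theta (a%:Z - b%:Z) *: y.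
Proof.
move=> dN [wd Lw Rw] abd.
have uR := uniform_raise t_gt1 Rm_deg uniform.
have uL := uniform_lower t_gt1 Rm_deg uniform.
(* [Lm Rm] preserves the degree, and fixing the degree is what bounds the height of every vector in
   [P] by [d]. *)
pose P (y : 'cV[C]_n) := (forall a, y a 0 != 0 -> deg a = (N - d)%N) /\ L *m y = 0.
apply: (@kerL_eigen_exists _ _ _ _ t gam t_gt1 gam_neq0 uR uL P d w) => //.
- split; first by split=> [i|]; rewrite ?mxE ?eqxx ?mulmx0.
  move=> c u v [ud Lu] [vd Lv]; split=> [i|]; last first.
    by rewrite mulmxDr -scalemxAr Lu Lv scaler0 addr0.
  rewrite !mxE; have [->|/ud //] := eqVneq (u i 0) 0.
  by rewrite mulr0 add0r => /vd.
- by move=> y [].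
- move=> y [yd Ly]; split; last by apply: (lower_kerL uL).
  move=> i; apply: contraNeq => di; rewrite mxE big1 // => j _.
  rewrite LmxE mxE; have [->|/Rm_deg dj] := eqVneq (Rm j i) 0; first by rewrite mulr0 mul0r.
  rewrite big1 ?mulr0 // => k _.
  have [->|/Rm_deg dk] := eqVneq (Rm j k) 0; first by rewrite mul0r.
  have [->|/yd] := eqVneq (y k 0) 0; first by rewrite mulr0.
  by move/eqP: di; lia.
- move=> y [yd _]; apply: (@iter_raise_eq0 _ _ N deg _ deg_le Rm_deg _ _ (N - d)).
    by move=> i /yd ->.
  by lia.
- by split=> //; rewrite /Lmx -mulmxA Lw mulmx0.
Qed.

(* The two strings [N, N-2, ..., -N] and [N-1, N-3, ..., 1-N], concatenated;
   [A*] does not mix them. *)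
Definition ord_weight (i : nat) : int :=
  if (i <= N)%N then N%:Z - (2 * i)%:Z else (3 * N + 1)%:Z - (2 * i)%:Z.

Lemma graded_Q_polynomial : Q_polynomial A (deg_alg C N deg) (2 * N).
Proof.
have uR := uniform_raise t_gt1 Rm_deg uniform.
have uL := uniform_lower t_gt1 Rm_deg uniform.
have th_inj := theta_inj t_gt1 gam_neq0.
pose V (i : 'I_(2 * N).+1) := passmx.leigenspace (mxact A) (theta (ord_weight i)).
have memV i v : (v \in V i) = (A *m v == theta (ord_weight i) *: v).
  exact: mem_leigenspace.
(* The parity of [N - (a + b)] selects the string; the position in it is [b] plus half of that
   difference. *)
have onto a b : (a + b <= N)%N ->
    exists i : 'I_(2 * N).+1, ord_weight i = a%:Z - b%:Z.
  move=> abN; rewrite /ord_weight; have := odd_double_half (N - (a + b)).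
  case: (odd _) => /= e.
    have lt : (N + 1 + b + (N - (a + b))./2 < (2 * N).+1)%N by lia.
    exists (Ordinal lt) => /=; case: leqP; lia.
  have lt : (b + (N - (a + b))./2 < (2 * N).+1)%N by lia.
  exists (Ordinal lt) => /=; case: leqP; lia.
have wt (i : 'I_(2 * N).+1) : exists a b : nat,
    ((a + b)%N = N \/ (a + b)%N = N.-1) /\ ord_weight i = a%:Z - b%:Z.
  have ltiN := ltn_ord i; rewrite /ord_weight; case: leqP => iN.
    by exists (N - i)%N, i; split; [left; lia | lia].
  by exists (2 * N - i)%N, (i - N.+1)%N; split; [right; lia | lia].
have ex (i : 'I_(2 * N).+1) : exists2 v : 'cV[C]_n, v != 0 & A *m v = theta (ord_weight i) *: v.
  have [a [b [abN ->]]] := wt i.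
  case: abN => abN; [have [w lw] := lowestN | have [w lw] := lowestN1].
    exact: (lowest_eigen _ lw).
  by apply: (lowest_eigen _ lw) => //; apply: leq_pred.
have wt_inj (i j : 'I_(2 * N).+1) : ord_weight i = ord_weight j -> i = j.
  move=> e; apply: val_inj => /=; have lti := ltn_ord i; have ltj := ltn_ord j.
  by move: e; rewrite /ord_weight; case: leqP => iN; case: leqP => jN; lia.
have spec (v : 'cV[C]_n) th : v != 0 -> A *m v = th *: v ->
    exists i : 'I_(2 * N).+1, th = theta (ord_weight i).
  move=> v0 Av; have [a [b [abN ->]]] := spectrum t_gt1 gam_neq0 deg_le Rm_deg Rm_real uniform v0 Av.
  by have [i <-] := onto a b abN; exists i.
exists V; split.
  split=> [i j Vij|U].
    have [v v0 Av] := ex i.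
    have : v \in V j by rewrite -Vij memV; apply/eqP.
    rewrite memV Av -subr_eq0 -scalerBl scaler_eq0 (negPf v0) orbF subr_eq0.
    by move/eqP/th_inj/wt_inj.
  split=> [[th /leigenvalueP[v v0 Av] ->]|[i <-]].
    by have [i ->] := spec v th v0 Av; exists i.
  by exists (theta (ord_weight i)) => //; apply/leigenvalueP; apply: ex.
exists S; split.
  apply: (@deg_diag_generates _ _ N deg deg_le (fun i => (Q ^+ i)^-1)).
  by move=> i j _ _ /invr_inj; apply: QX_inj.
move=> i; apply/subvP=> x /memv_imgP[v Vv ->]; rewrite lfunE /=.
set s := ord_weight i.
have extVE (j : 'I_(2 * N).+1) k : k = Posz j -> extV V k = V j.
  by move=> -> /=; rewrite valK.
move: Vv; rewrite memV => /eqP Av.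
have S3 := tridiagonal t_gt1 uR uL (Smx_raise t_gt1 Rm_deg) (Smx_lower t_gt1 Rm_deg) Av.
have theta_neq a b : a != b -> theta a != theta b by apply: contra_neq => /th_inj.
apply: (@eigen_decomp _ _ A _ (fun=> True)
  (fun y => y \in (extV V (i%:Z - 1) + extV V i%:Z + extV V (i%:Z + 1))%VS)
  _ _ _ _ _ _ I S3) => //.
- rewrite /= !inE !negb_or !theta_neq //; apply/eqP; lia.
- by split=> [|a u v' uW vW]; rewrite ?mem0v // memvD ?memvZ.
move=> th y; rewrite !inE => thE _ Ay.
(* At an end of a string one of the three values is not an eigenvalue of [A]; its component is 0. *)
have [->|y0] := eqVneq y 0; first exact: mem0v.
have [j thj] := spec y th y0 Ay.
have yVj : y \in V j by rewrite memV -thj Ay.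
(* The two strings have opposite parities, so a weight at distance 2 from [s] lies in the same
   string, at an adjacent index. *)
have nbr : [\/ Posz j = i%:Z - 1, Posz j = i%:Z | Posz j = i%:Z + 1].
  have {thE} : [\/ ord_weight j = s, ord_weight j = s + 2 | ord_weight j = s - 2].
    by case/or3P: thE; rewrite thj => /eqP/th_inj ->; [apply: Or31 | apply: Or32 | apply: Or33].
  have lti := ltn_ord i; have ltj := ltn_ord j; rewrite /s /ord_weight.
  case: leqP => jN; case: leqP => iN [] e;
    by first [apply: Or31; lia | apply: Or32; lia | apply: Or33; lia | lia].
case: nbr => e; rewrite (extVE j _ (esym e)).
- by apply: subvP yVj; rewrite -addvA addvSl.
- by apply: subvP yVj; apply: subv_trans (addvSl _ _); apply: addvSr.
- by apply: subvP yVj; rewrite addvSr.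
Qed.

End GradedQPolynomial.

(** * Counting in the Attenuated Space poset *)

Section Counting.
Import finfield.
Variables (F : finFieldType) (H : vectType F) (h : {vspace H}).
Local Notation X := (att_space h).
Local Notation q := #|F|.
Implicit Types (x y z a b c : X) (U V T B : {vspace H}).

Lemma dim_addv_line U (v : H) : v \notin U -> \dim (U + <[v]>) = (\dim U).+1.
Proof.
move=> vU; rewrite dimv_disjoint_sum ?dim_vline.
  by rewrite (_ : v != 0) ?addn1 //; apply: contraNneq vU => ->; rewrite mem0v.
apply/eqP; rewrite -subv0; apply/subvP=> w; rewrite memv_cap memv0 => /andP[wU /vlineP[k wk]].
have [k0|k0] := eqVneq k 0; first by rewrite wk k0 scale0r.
by case/negP: vU; rewrite -(scalerK k0 v) -wk memvZ.
Qed.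

Lemma mem_addv_line U (v : H) : v \in (U + <[v]>)%VS.
Proof. exact: (subvP (addvSr U <[v]>)) (memv_line v). Qed.

Lemma card_vspaceE U : #|[pred v : finvect_type H | v \in U]| = (q ^ \dim U)%N.
Proof.
case: H U => T cT U.
exact: (@card_vspace F (finvect_type (Vector.Pack cT)) cT U).
Qed.

Lemma card_vspace_sub U V : (U <= V)%VS ->
  #|[pred v : finvect_type H | (v \in V) && (v \notin U)]| = (q ^ \dim V - q ^ \dim U)%N.
Proof.
move=> UV; rewrite -!card_vspaceE.
rewrite -(cardID [pred v : finvect_type H | v \in U] [pred v : finvect_type H | v \in V]).
rewrite (_ : #|[predI _ & _]| = #|[pred v : finvect_type H | v \in U]|).
  by rewrite addKn; apply: eq_card => v; rewrite !inE andbC.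
apply: eq_card => v; rewrite !inE; case vU: (v \in U); rewrite ?andbF //.
by rewrite andbT; apply: (subvP UV).
Qed.

Lemma attP x : (val x :&: h = 0)%VS.
Proof. exact/eqP/(valP x). Qed.

Lemma sub_att x V : (V <= val x)%VS -> (V :&: h)%VS = 0%VS.
Proof. by move=> Vx; apply/eqP; rewrite -subv0 -(attP x) capvS. Qed.

Definition mkatt a V : X := insubd a V.

Lemma mkattK a V : (V :&: h)%VS = 0%VS -> val (mkatt a V) = V.
Proof. by move=> Vh; rewrite insubdK // -topredE /= Vh. Qed.

Lemma coversP z y : reflect ((val y <= val z)%VS /\ \dim (val z) = (\dim (val y)).+1) (covers z y).
Proof. by apply: (iffP andP) => -[-> /eqP]. Qed.

Lemma cover_cap c a T : covers c a -> (val a <= T)%VS -> ~~ (val c <= T)%VS ->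
  (val c :&: T)%VS = val a.
Proof.
move=> /coversP[ac dc] aT cT; apply/eqP; rewrite eq_sym eqEdim subv_cap ac aT /=.
have : (\dim (val c :&: T) < \dim (val c))%N.
  rewrite ltn_neqAle dimvS ?capvSl // andbT; apply: contra cT => e.
  by rewrite -(eqP (_ : (val c :&: T)%VS == val c)) ?capvSr // eqEdim capvSl (eqP e) /=.
by rewrite dc ltnS.
Qed.

(** Double counting: each such [c] is [a + <[v]>] for exactly the vectors [v] of [c] outside [a],
    and these lie in [U] outside [T]. Intervals use [T = a]; all upper covers use [T = a + h]. *)
Lemma card_covers a U T : (val a <= T)%VS -> (T <= U)%VS ->
  (forall v, v \in U -> v \notin T -> ((val a + <[v]>) :&: h)%VS = 0%VS) ->
  (#|[pred c : X | [&& covers c a, (val c <= U)%VS & ~~ (val c <= T)%VS]]|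
     * (q ^ (\dim (val a)).+1 - q ^ \dim (val a)) = q ^ \dim U - q ^ \dim T)%N.
Proof.
move=> aT TU ah; rewrite -card_vspace_sub // -[RHS]sum1_card -[X in (X * _)%N]sum1_card big_distrl /=.
pose f (v : H) : X := mkatt a (val a + <[v]>)%VS.
pose Qc := [pred c : X | [&& covers c a, (val c <= U)%VS & ~~ (val c <= T)%VS]].
have aU := subv_trans aT TU.
have fE (v : H) : v \in U -> v \notin T -> val (f v) = (val a + <[v]>)%VS.
  by move=> vU vT; apply/mkattK/ah.
have va (v : H) : v \notin T -> v \notin val a by apply: contra; apply: (subvP aT).
rewrite [RHS](partition_big (f : finvect_type H -> X) Qc) /=; last first.
  move=> v; rewrite inE => /andP[vU vT].
  change (is_true [&& covers (f v) a, (val (f v) <= U)%VS & ~~ (val (f v) <= T)%VS]).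
  rewrite /covers fE // addvSl dim_addv_line ?va // eqxx.
  rewrite subv_add aU -memvE vU /=; apply: contra vT => /subvP; apply.
  exact: mem_addv_line.
apply: eq_bigr => c /and3P[/[dup] cca /coversP[ac dc] cU cT].
rewrite mul1n -dc -card_vspace_sub // -[LHS]sum1_card; apply: eq_bigl => v; rewrite !inE.
apply/andP/andP => [[vc va']|[/andP[vU vT] /eqP <-]]; last first.
  by rewrite fE // va //; split=> //; apply: mem_addv_line.
have vU : v \in U by apply: subvP vc.
have vT : v \notin T.
  apply: contra va' => vT.
  by have : (v : H) \in (val c :&: T)%VS; [apply/memv_capP | rewrite (cover_cap cca aT cT)].
rewrite vU vT; split=> //; apply/eqP/val_inj; rewrite fE //; apply/eqP.
by rewrite eqEdim subv_add ac -memvE vc dim_addv_line // dc /=.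
Qed.

Lemma q_gt1 : (1 < q)%N. Proof. exact: finNzRing_gt1. Qed.

Lemma qX_gap j : (0 < q ^ j.+1 - q ^ j)%N.
Proof. by rewrite subn_gt0 ltn_exp2l ?q_gt1. Qed.

Lemma card_interval a z : (val a <= val z)%VS -> \dim (val z) = (\dim (val a)).+2 ->
  #|[pred b : X | covers b a && covers z b]| = q.+1.
Proof.
move=> az dz; apply/eqP; rewrite -(eqn_pmul2r (qX_gap (\dim (val a)))).
have ah (v : H) : v \in val z -> v \notin val a -> ((val a + <[v]>) :&: h)%VS = 0%VS.
  by move=> vz _; apply: (@sub_att z); rewrite subv_add az -memvE.
have := card_covers (subvv _) az ah.
rewrite (_ : #|_| = #|[pred b : X | covers b a && covers z b]|) => [->|].
  by rewrite dz !expnS; have := q_gt1; move: (q) (q ^ _)%N => Q P; nia.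
apply: eq_card => b; rewrite !inE; apply/and3P/andP => [[ba bz _]|[ba /coversP[bz db]]].
  split=> //; apply/coversP; split=> //; rewrite dz; congr _.+1.
  by case/coversP: ba => _ ->.
split=> //; apply/negP=> /dimvS; case/coversP: ba => _ ->; by rewrite ltnn.
Qed.

(** By the modular law, [c] inside [a + h] would give [c = a + (c :&: h) = a]. *)
Lemma cover_nsub_addh c a : covers c a -> ~~ (val c <= val a + h)%VS.
Proof.
move=> /coversP[ac dc]; apply/negP=> cah.
have : (val c <= val a)%VS.
  rewrite -(capv_idPl cah) capvC -vspace_modl //.
  by rewrite [(h :&: _)%VS]capvC attP addv0.
by move/dimvS; rewrite dc ltnn.
Qed.

Lemma card_upcovers a N M : \dim {: H} = (N + M)%N -> \dim h = M ->
  (#|[pred c : X | covers c a]| * (q ^ (\dim (val a)).+1 - q ^ \dim (val a)) =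
   q ^ (N + M) - q ^ (\dim (val a) + M))%N.
Proof.
move=> dH dh; have ah : \dim (val a + h) = (\dim (val a) + M)%N.
  by rewrite dimv_disjoint_sum ?dh ?attP.
rewrite -dH -ah -(@card_covers a fullv (val a + h)%VS) ?addvSl ?subvf //.
  congr (_ * _)%N; apply: eq_card => c; rewrite !inE subvf /=.
  by case: (boolP (covers c a)) => //= /cover_nsub_addh ->.
move=> v _ vah; apply/eqP; rewrite -subv0; apply/subvP=> w.
rewrite memv_cap memv0 => /andP[/memv_addP[u ua [_ /vlineP[k ->] ->]] uh].
have [k0|k0] := eqVneq k 0.
  rewrite k0 scale0r addr0 in uh *.
  by rewrite -memv0 -(attP a) memv_cap ua.
case/negP: vah; rewrite -(scalerK k0 v) memvZ // -[k *: v](addKr u) memv_add //.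
by rewrite memvN.
Qed.

(** [P] singles out the space [V], which is an element of the poset exactly when it meets [h]
    trivially; [x0] supplies the default of [mkatt]. *)
Lemma card_join (x0 : X) V (P : pred X) : (forall c, P c -> val c = V) ->
  ((V :&: h)%VS = 0%VS -> forall c, val c = V -> P c) ->
  #|P| = ((V :&: h)%VS == 0%VS :> {vspace H}).
Proof.
move=> PV VP; have [Vh|/eqP Vh] := eqVneq.
  have eV := mkattK x0 Vh; apply: (@eq_card1 X (mkatt x0 V)) => c.
  rewrite [RHS]inE /= [LHS]unfold_in. apply/idP/eqP => [Pc|->]; last exact: VP.
  by apply: val_inj; rewrite eV; apply: PV.
by apply: (@eq_card0 X) => c; apply/negP => Pc; case: Vh; rewrite -(PV _ Pc) attP.
Qed.

Lemma dim_cap_lt y V : ~~ (val y <= V)%VS -> (\dim (val y :&: V) < \dim (val y))%N.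
Proof.
move=> yV; rewrite ltn_neqAle dimvS ?capvSl // andbT; apply: contra yV => e.
by rewrite -(eqP (_ : (val y :&: V)%VS == val y)) ?capvSr // eqEdim capvSl (eqP e) /=.
Qed.

Lemma nsub_eqdim y b : \dim (val y) = \dim (val b) -> y != b -> ~~ (val y <= val b)%VS.
Proof.
move=> d; apply: contra => yb; apply/eqP/val_inj/eqP.
by rewrite eqEdim yb d /=.
Qed.

Lemma card_common_cover y b : \dim (val y) = \dim (val b) -> y != b ->
  (\dim (val y :&: val b)).+1 = \dim (val y) ->
  #|[pred c : X | covers c y && covers c b]| = (((val y + val b) :&: h)%VS == 0%VS).
Proof.
move=> d yb dyb; have := dimv_sum_cap (val y) (val b); rewrite -d => ds.
apply: (card_join y) => [c /andP[/coversP[yc dc] /coversP[bc _]]|_ c e].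
  apply/esym/eqP; rewrite eqEdim subv_add yc bc dc; lia.
by rewrite inE; apply/andP; split; apply/coversP; rewrite e ?addvSl ?addvSr -?d; split=> //; lia.
Qed.

Lemma common_cover_cap c y b : covers c y -> covers c b -> y != b ->
  (\dim (val y :&: val b)).+1 = \dim (val y).
Proof.
move=> /coversP[yc dc] /coversP[bc dc'] yb.
have d : \dim (val y) = \dim (val b) by move: dc'; rewrite dc => -[].
have := dim_cap_lt (nsub_eqdim d yb); have := dimv_sum_cap (val y) (val b).
have : (val y + val b <= val c)%VS by rewrite subv_add yc.
by move/dimvS; lia.
Qed.

Lemma card_common_covered y b :
  (\dim (val y :&: val b)).+1 = \dim (val y) -> \dim (val y) = \dim (val b) ->
  #|[pred a : X | covers y a && covers b a]| = 1%N.
Proof.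
move=> dyb d.
have yh : ((val y :&: val b) :&: h)%VS = 0%VS by apply: (@sub_att y); apply: capvSl.
rewrite (@card_join y (val y :&: val b)%VS) ?yh ?eqxx // => [a|_ a e].
  case/andP=> /coversP[ay dy] /coversP[ab db]; apply/eqP.
  by rewrite eqEdim subv_cap ay ab /= -ltnS dyb dy.
by rewrite inE; apply/andP; split; apply/coversP; rewrite e ?capvSl ?capvSr dyb -?d.
Qed.

Lemma card_interval_neq a y z : covers y a -> covers z y ->
  #|[pred b : X | [&& covers b a, covers z b & b != y]]| = q.
Proof.
move=> ya zy; apply/eqP; rewrite -eqSS -(@card_interval a z).
- rewrite -[X in _ == X]sum1_card (bigD1 y) ?inE ?ya ?zy //= add1n eqSS -sum1_card.
  by apply/eqP/eq_bigl => b; rewrite !inE andbA.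
- by case/coversP: ya => ay _; case/coversP: zy => yz _; apply: subv_trans ay yz.
- by case/coversP: ya => _ <-; case/coversP: zy.
Qed.

(** For [dim z = dim y + 1], the [(y, z)] entries of [R R^T R^T] and [R^T R^T R] are [q + 1] times
    [below_count] and [above_count]; that of [R^T R R^T] is [zigzag_count]. *)
Definition below_count y z := #|[pred a : X | covers y a && (val a <= val z)%VS]|.
Definition above_count y z := #|[pred c : X | covers c z && (val y <= val c)%VS]|.
Definition zigzag_count y z :=
  (\sum_(b | covers z b) #|[pred c : X | covers c y && covers c b]|)%N.

(** Here c1 = K (RQ - 1)/(Q - 1) and c2 = K (R - 1)/(Q - 1), in the form in which [card_upcovers]
    delivers them. *)
Lemma telescope_count (Q P R K c1 c2 : nat) : (1 < Q)%N -> (0 < P)%N -> (0 < R)%N ->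
  (c1 * (Q * P - P) = R * (Q * P) * K - P * K)%N ->
  (c2 * (Q * (Q * P) - Q * P) = R * (Q * P) * K - Q * P * K)%N -> (c1 = c2 + R * K)%N.
Proof.
case: Q => // Q Q0 P0 R0 H1 H2.
have e1 : (c1 * (Q * P) + P * K = R * (Q.+1 * P) * K)%N.
  rewrite mulSn addKn in H1; rewrite H1 subnK // leq_mul2r; apply/orP; right.
  by rewrite (leq_trans (leq_addr (Q * P) P)) // leq_pmull.
have e2 : (c2 * (Q * (Q.+1 * P)) + Q.+1 * P * K = R * (Q.+1 * P) * K)%N.
  by rewrite mulSn addKn in H2; rewrite H2 subnK // leq_mul2r leq_pmull // orbT.
have QP : (0 < Q * (Q.+1 * P))%N by rewrite !muln_gt0 P0 -ltnS Q0.
apply/eqP; rewrite -(eqn_pmul2r QP); apply/eqP.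
have := congr1 (muln Q.+1) e1; lia.
Qed.

Lemma upcover_diff y z N M : \dim {: H} = (N + M)%N -> \dim h = M -> covers z y ->
  #|[pred c : X | covers c y]| =
  (#|[pred c : X | covers c z]| + q ^ (N + M - \dim (val z)))%N.
Proof.
move=> dH dh /coversP[_ dz].
have dzN : (\dim (val z) + M <= N + M)%N.
  by rewrite -dH -dh -dimv_disjoint_sum ?attP // dimvS ?subvf.
have := card_upcovers y dH dh; have := card_upcovers z dH dh.
move: #|[pred c : X | covers c z]| #|[pred c : X | covers c y]| => cz cy.
rewrite dz; rewrite dz in dzN.
have [r ->] : exists r, N = (r + (\dim (val y)).+1)%N.
  by exists (N - (\dim (val y)).+1)%N; rewrite subnK // -(leq_add2r M).
rewrite (_ : r + _ + M - _ = r + M)%N; last by rewrite addnAC addnK.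
rewrite !expnD !expnS; have := q_gt1; move: (q) => Q Q1 Hz Hy.
apply: (@telescope_count Q (Q ^ \dim (val y)) (Q ^ r) (Q ^ M)) => //.
- by rewrite expn_gt0 ltnW.
- by rewrite expn_gt0 ltnW.
Qed.

(** In the zigzag sum, [b = y] counts the upper covers of [y], which [upcover_diff] compares with
    those of [z]. Every other [b] contributes 1, since [y + b = z]; grouping these by [a = y :&: b]
    gives [q] choices of [b] for each [a]. *)
Lemma count_sub y z N M : \dim {: H} = (N + M)%N -> \dim h = M -> covers z y ->
  (q * below_count y z + above_count y z + q ^ (N + M - \dim (val z)) = zigzag_count y z)%N.
Proof.
move=> dH dh zy; case/coversP: (zy) => yz dz.
have -> : above_count y z = #|[pred c : X | covers c z]|.
  apply: (@eq_card X) => c; rewrite !inE andb_idr // => /coversP[zc _].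
  exact: subv_trans yz zc.
rewrite /zigzag_count (bigD1 y) //=.
rewrite (_ : #|[pred c : X | covers c y && covers c y]| = #|[pred c : X | covers c y]|); last first.
  by apply: (@eq_card X) => c; rewrite !inE andbb.
rewrite (upcover_diff dH dh zy) -addnA addnC; congr (_ + _)%N.
transitivity (\sum_(b | covers z b && (b != y)) 1)%N; last first.
  apply: eq_bigr => b /andP[/[dup] zb /coversP[bz dz'] by_].
  have d : \dim (val y) = \dim (val b) by move: dz'; rewrite dz => -[].
  rewrite card_common_cover // 1?eq_sym //; last first.
    by apply: (common_cover_cap zy zb); rewrite eq_sym.
  by rewrite (@sub_att z) ?eqxx // subv_add yz.
transitivity (\sum_(b | covers z b && (b != y)) \sum_(a | covers y a && covers b a) 1)%N; last first.
  apply: eq_bigr => b /andP[/[dup] zb /coversP[bz dz'] by_].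
  have d : \dim (val y) = \dim (val b) by move: dz'; rewrite dz => -[].
  by rewrite sum1_card card_common_covered // (common_cover_cap zy zb) // eq_sym.
rewrite (exchange_big_dep (fun a => covers y a && (val a <= val z)%VS)) /=; last first.
  move=> b a /andP[/coversP[bz _] _] /andP[-> /coversP[ab _]]; exact: subv_trans ab bz.
rewrite /below_count -[X in (_ * X)%N]sum1_card big_distrr /=; apply: eq_bigr => a /andP[ya az].
rewrite muln1 -[LHS](card_interval_neq ya zy) -[LHS]sum1_card; apply: eq_bigl => b.
by rewrite !inE ya; case: (covers b a); case: (covers z b); case: (b == y).
Qed.

(** When [y :&: z] is a hyperplane of [y], the sum runs over the [q + 1] elements [b] between it and
    [z], each counted if [y + b] avoids [h]. Either all are counted and [y + z] is the one common
    upper bound, or exactly one fails and there is none. *)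
Lemma count_nsub y z : ~~ (val y <= val z)%VS -> \dim (val z) = (\dim (val y)).+1 ->
  (q * below_count y z + above_count y z = zigzag_count y z)%N.
Proof.
move=> yz dz; have ltc := dim_cap_lt yz.
have zy b : covers z b -> y != b by move=> /coversP[bz _]; apply: contraNneq yz => ->.
have dzb b : covers z b -> \dim (val y) = \dim (val b).
  by case/coversP=> _; rewrite dz => -[].
have ds := dimv_sum_cap (val y) (val z).
have capz b : covers z b -> (\dim (val y :&: val b) <= \dim (val y :&: val z))%N.
  by case/coversP=> bz _; rewrite dimvS ?capvS.
(* If [y :&: z] has codimension at least 2 in [y], all three counts vanish. *)
have [dc|dc] := eqVneq (\dim (val y :&: val z)).+1 (\dim (val y)); last first.
  have -> : (below_count y z = 0)%N.
    apply: (@eq_card0 X) => a; apply/negP=> /andP[/coversP[ay da] az].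
    have : (val a <= val y :&: val z)%VS by rewrite subv_cap ay.
    by move/dimvS; lia.
  have -> : (above_count y z = 0)%N.
    apply: (@eq_card0 X) => c; apply/negP=> /andP[/coversP[zc dc'] yc].
    have : (val y + val z <= val c)%VS by rewrite subv_add yc.
    by move/dimvS; lia.
  rewrite muln0 /zigzag_count big1 // => b zb.
  apply: (@eq_card0 X) => c; apply/negP=> /andP[cy cb].
  by have := common_cover_cap cy cb (zy b zb); have := capz b zb; lia.
have yzh : ((val y :&: val z) :&: h)%VS = 0%VS by apply: (@sub_att y); apply: capvSl.
pose a0 := mkatt y (val y :&: val z)%VS; have a0E := mkattK y yzh.
have za0 : (val a0 <= val z)%VS by rewrite a0E capvSr.
have ya0 : (val a0 <= val y)%VS by rewrite a0E capvSl.
have -> : (below_count y z = 1)%N.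
  rewrite /below_count (@card_join y (val y :&: val z)%VS) ?yzh ?eqxx // => [a|_ a e].
    case/andP=> /coversP[ay da] az; apply/eqP.
    by rewrite eqEdim subv_cap ay az; lia.
  by rewrite inE; apply/andP; split; [apply/coversP|]; rewrite e ?capvSl ?capvSr ?dc.
have -> : above_count y z = (((val y + val z) :&: h)%VS == 0%VS).
  apply: (card_join y) => [c /andP[/coversP[zc dc'] yc]|_ c e].
    apply/esym/eqP; rewrite eqEdim subv_add yc zc dc'; lia.
  by rewrite inE; apply/andP; split; [apply/coversP; split|]; rewrite e ?addvSl ?addvSr //; lia.
have capE b : covers z b -> covers b a0 -> (val y :&: val b)%VS = val a0.
  move=> zb /coversP[ab dab]; apply/eqP; rewrite eq_sym eqEdim subv_cap ya0 ab /= a0E.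
  exact: capz.
have -> : zigzag_count y z =
    (\sum_(b | covers b a0 && covers z b) (((val y + val b) :&: h)%VS == 0%VS))%N.
  rewrite /zigzag_count (bigID (fun b => covers b a0)) /= [X in (_ + X)%N]big1 ?addn0.
    apply: congr_big => // [b|b /andP[zb ba]]; first by rewrite andbC.
    by apply: card_common_cover; [exact: dzb | exact: zy | rewrite (capE b) // a0E dc].
  move=> b /andP[zb nba]; apply: (@eq_card0 X) => c; apply/negP=> /andP[cy cb]; case/negP: nba.
  have e := common_cover_cap cy cb (zy b zb).
  have eq : (val y :&: val b)%VS = val a0.
    apply/eqP; rewrite a0E eqEdim capvS //; last by case/coversP: zb.
    by rewrite -ltnS dc e leqnn.
  by apply/coversP; rewrite -eq capvSr e -(dzb b zb).
have : \dim (val z) = (\dim (val a0)).+2 by rewrite a0E dc dz.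
move=> /(card_interval za0); rewrite -sum1_card.
(* Splitting the [q + 1] elements by whether [y + b] meets [h] reduces the claim to counting the
   failures: none if [y + z] avoids [h], one otherwise. *)
rewrite (eq_bigr (fun b => ((((val y + val b) :&: h)%VS == 0%VS) + (((val y + val b) :&: h)%VS != 0%VS))%N)); last first.
  by move=> b _; case: eqP.
rewrite big_split /= muln1 => e.
apply/eqP; rewrite -(eqn_add2r (\sum_(b | covers b a0 && covers z b) (((val y + val b) :&: h)%VS != 0%VS))%N) e -addnA -addn1 eqn_add2l.
apply/eqP.
have [yzh0|yzh0] := eqVneq ((val y + val z) :&: h)%VS 0%VS.
  rewrite big1 // => b /andP[_ /coversP[bz _]].
  have : ((val y + val b) :&: h <= (val y + val z) :&: h)%VS by rewrite capvS // addvS.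
  by rewrite yzh0 subv0 => ->.
rewrite add0n.
set l := ((val y + val z) :&: h)%VS in yzh0.
have lz : (l :&: val z)%VS = 0%VS.
  have : (l :&: val z <= val z :&: h)%VS by rewrite capvC capvS // capvSr.
  by rewrite attP subv0 => /eqP.
have ly : (val y :&: l)%VS = 0%VS.
  have : (val y :&: l <= val y :&: h)%VS by rewrite capvS // capvSr.
  by rewrite attP subv0 => /eqP.
(* [l] meets [z] trivially inside [y + z], whose dimension is only [dim z + 1]. *)
have l1 : \dim l = 1%N.
  have : (l + val z <= val y + val z)%VS by rewrite subv_add capvSl addvSr.
  move/dimvS; rewrite dimv_disjoint_sum //.
  by move: yzh0; rewrite -dimv_eq0; lia.
have dyl : \dim (val y + l) = (\dim (val y)).+1 by rewrite dimv_disjoint_sum // l1 addn1.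
have b0sub : ((val y + l) :&: val z <= val z)%VS by apply: capvSr.
(* The unique failure: if [y + b] meets [h], it contains [l] and equals [y + l], so [b] is the trace
   of [y + l] on [z]. *)
pose b0 := mkatt z ((val y + l) :&: val z)%VS.
have b0E : val b0 = ((val y + l) :&: val z)%VS by apply/mkattK/(@sub_att z)/capvSr.
have db0 : \dim (val b0) = \dim (val y).
  rewrite b0E; have := dimv_sum_cap (val y + l)%VS (val z).
  have : (val y + l + val z <= val y + val z)%VS.
    by rewrite !subv_add addvSl addvSr capvSl.
  have : (val y + val z <= val y + l + val z)%VS by rewrite addvS // addvSl.
  by move=> /dimvS i1 /dimvS i2; rewrite dyl dz; lia.
have zb0 : covers z b0 by apply/coversP; rewrite b0E capvSr -b0E db0.
have b0a0 : covers b0 a0.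
  apply/coversP; rewrite db0 a0E dc b0E; split=> //.
  by rewrite capvS // addvSl.
have dyb b : covers z b -> covers b a0 -> \dim (val y + val b) = (\dim (val y)).+1.
  move=> zb ba; apply/eqP; rewrite -(eqn_add2r (\dim (val a0))) -[in X in X == _](capE b) //.
  by rewrite dimv_sum_cap -(dzb b zb) addSnnS a0E dc.
have lmeet b : covers z b -> covers b a0 ->
    (((val y + val b) :&: h)%VS != 0%VS) = (b == b0).
  move=> zb ba; have bz : (val b <= val z)%VS by case/coversP: zb.
  apply/idP/eqP => [meet|->].
    have ml : ((val y + val b) :&: h <= l)%VS by rewrite capvS // addvS.
    have le : ((val y + val b) :&: h)%VS = l.
      by apply/eqP; rewrite eqEdim ml l1 lt0n dimv_eq0.
    have yl : (val y + l)%VS = (val y + val b)%VS.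
      have lb : (l <= val y + val b)%VS by rewrite -le capvSl.
      by apply/eqP; rewrite eqEdim subv_add addvSl lb dyl dyb ?leqnn.
    apply/val_inj/eqP; rewrite eqEdim b0E yl subv_cap addvSr bz /=.
    by rewrite -yl -b0E db0 (dzb b zb).
  have : (val y + val b0 <= val y + l)%VS by rewrite subv_add addvSl b0E capvSl.
  have -> : (val y + val b0)%VS = (val y + l)%VS.
    by apply/eqP; rewrite eqEdim dyb // dyl subv_add addvSl b0E capvSl leqnn.
  move=> _; apply: contra yzh0; rewrite -!subv0; apply: subv_trans.
  by rewrite subv_cap addvSr capvSr.
rewrite (bigD1 b0) ?b0a0 //= lmeet // eqxx big1 // => b /andP[/andP[ba zb] bb0].
by rewrite lmeet // (negPf bb0).
Qed.

End Counting.

Lemma mulmx_sub_eq0 (C : numClosedFieldType) n (A : 'M[C]_n) (u v : 'cV[C]_n) :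
  A *m u = A *m v -> A *m (u - v) = 0.
Proof. by rewrite mulmxBr => ->; rewrite subrr. Qed.

(** * The covering matrix *)

Section CoverMatrix.
Variables (C : numClosedFieldType) (F : finFieldType) (H : vectType F) (h : {vspace H}).
Variables (N M : nat).
Hypotheses (dimH : \dim {: H} = (N + M)%N) (dimh : \dim h = M).
Local Notation X := (att_space h).
Local Notation q := #|F|.
Implicit Types (x y z a b c : X).

Definition att_deg (i : 'I_#|X|) := \dim (val (enum_val i : X)).
Definition cover_mx : 'M[C]_#|X| := \matrix_(i, j) (covers (enum_val i) (enum_val j))%:R.
Local Notation Rm := cover_mx.

Definition att_t : C := sqrtC q%:R.
Definition att_gam : C := att_t ^+ (N + M).
Local Notation t := att_t.

Lemma att_t2 : t ^+ 2 = q%:R. Proof. exact: sqrtCK. Qed.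

Lemma att_t_gt1 : 1 < t.
Proof.
suff : 1 < t ^+ 2 by rewrite expr_gt1 // sqrtC_ge0 ler0n.
by rewrite att_t2 (_ : 1 = 1%:R :> C) // ltr_nat q_gt1.
Qed.

Lemma att_gam_neq0 : att_gam != 0.
Proof. by rewrite expf_neq0 // lt0r_neq0 // (lt_trans _ att_t_gt1). Qed.

Lemma dim_att_le x : (\dim (val x) <= N)%N.
Proof.
by rewrite -(leq_add2r M) -dimH -[M in X in (X <= _)%N]dimh -dimv_disjoint_sum ?attP // dimvS ?subvf.
Qed.

Lemma cover_mx_deg i j : Rm i j != 0 -> att_deg i = (att_deg j).+1.
Proof.
rewrite mxE /att_deg; case: (boolP (covers _ _)) => [/coversP[_ ->] //|_].
by rewrite eqxx.
Qed.

Lemma cover_mx_real i j : (Rm i j)^* = Rm i j.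
Proof. by rewrite mxE conjC_nat. Qed.

Lemma sum_att (V : nmodType) (f : X -> V) : \sum_(i < #|X|) f (enum_val i) = \sum_x f x.
Proof. by rewrite -big_enum_val. Qed.

Lemma card_pred_sum (P : pred X) : #|P| = (\sum_x P x)%N.
Proof. by rewrite -sum1_card big_mkcond. Qed.

Definition RRtRt y z := (\sum_b (\sum_a covers y a * covers b a) * covers z b)%N.
Definition RtRRt y z := (\sum_b (\sum_c covers c y * covers c b) * covers z b)%N.
Definition RtRtR y z := (\sum_c (\sum_b covers b y * covers c b) * covers c z)%N.

(** For each [a] below both [y] and [z], the middle element ranges over the interval from [a] to
    [z], which has [q + 1] elements. *)
Lemma RRtRtE y z : \dim (val z) = (\dim (val y)).+1 ->
  RRtRt y z = (q.+1 * below_count y z)%N.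
Proof.
move=> dz; rewrite /RRtRt.
under eq_bigr do rewrite big_distrl.
rewrite exchange_big /below_count card_pred_sum big_distrr /=; apply: eq_bigr => a _.
case: (boolP (covers y a)) => [/coversP[ay da]|_] /=; last first.
  by rewrite muln0 big1.
under eq_bigr do rewrite mul1n.
have [az|naz] := boolP (val a <= val z)%VS; last first.
  rewrite muln0 big1 // => b _; apply/eqP; rewrite mulnb eqb0; apply: contra naz.
  by case/andP=> /coversP[ab _] /coversP[bz _]; apply: subv_trans ab bz.
rewrite muln1 -(@card_interval _ _ _ a z) ?dz ?da // card_pred_sum.
by apply: eq_bigr => b _; rewrite mulnb.
Qed.

Lemma RtRtRE y z : \dim (val z) = (\dim (val y)).+1 ->
  RtRtR y z = (q.+1 * above_count y z)%N.
Proof.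
move=> dz; rewrite /RtRtR /above_count card_pred_sum big_distrr /=; apply: eq_bigr => c _.
case: (boolP (covers c z)) => [/coversP[zc dc]|_] /=; last by rewrite !muln0.
rewrite muln1; have [yc|nyc] := boolP (val y <= val c)%VS; last first.
  rewrite muln0 big1 // => b _; apply/eqP; rewrite mulnb eqb0; apply: contra nyc.
  by case/andP=> /coversP[yb _] /coversP[bc _]; apply: subv_trans yb bc.
rewrite muln1 -(@card_interval _ _ _ y c) ?dc ?dz // card_pred_sum.
by apply: eq_bigr => b _; rewrite mulnb.
Qed.

Lemma RtRRtE y z : RtRRt y z = zigzag_count y z.
Proof.
rewrite /zigzag_count /RtRRt [RHS]big_mkcond; apply: eq_bigr => b _ /=.
case: (covers z b); rewrite ?muln0 // muln1 card_pred_sum.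
by apply: eq_bigr => c _; rewrite mulnb.
Qed.

Lemma uniform_count y z : \dim (val z) = (\dim (val y)).+1 ->
  (q * RRtRt y z + RtRtR y z + q.+1 * q ^ (N + M - \dim (val z)) * covers z y
   = q.+1 * RtRRt y z)%N.
Proof.
move=> dz; rewrite RRtRtE // RtRtRE // RtRRtE.
have [zy|nzy] := boolP (covers z y).
  by rewrite -(count_sub dimH dimh zy) muln1 [RHS]mulnDr [X in _ = (X + _)%N]mulnDr mulnCA.
rewrite muln0 addn0 -count_nsub //; first by rewrite [RHS]mulnDr mulnCA.
by apply: contra nzy => yz; apply/coversP.
Qed.

Lemma uniform_count0 y z : \dim (val z) != (\dim (val y)).+1 ->
  [/\ RRtRt y z = 0, RtRtR y z = 0, RtRRt y z = 0 & covers z y = false]%N.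
Proof.
move=> dz; split.
- rewrite /RRtRt big1 // => b _; rewrite big_distrl big1 //= => a _.
  apply/eqP; rewrite !mulnb eqb0; apply: contra dz.
  by case/andP=> /andP[/coversP[_ e1] /coversP[_ e2]] /coversP[_ e3]; rewrite e3 e2 e1.
- rewrite /RtRtR big1 // => b _; rewrite big_distrl big1 //= => a _.
  apply/eqP; rewrite !mulnb eqb0; apply: contra dz.
  by case/andP=> /andP[/coversP[_ e1] /coversP[_ e2]] /coversP[_]; rewrite e2 e1 => -[->].
- rewrite /RtRRt big1 // => b _; rewrite big_distrl big1 //= => a _.
  apply/eqP; rewrite !mulnb eqb0; apply: contra dz.
  by case/andP=> /andP[/coversP[_ e1] /coversP[_]]; rewrite e1 => -[->] /coversP[_ ->].
by apply: contraNF dz => /coversP[_ ->].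
Qed.

Lemma mul_cover (A B D : 'M[C]_#|X|) (fa fb fd : X -> X -> bool) :
  (forall i j, A i j = (fa (enum_val i) (enum_val j))%:R) ->
  (forall i j, B i j = (fb (enum_val i) (enum_val j))%:R) ->
  (forall i j, D i j = (fd (enum_val i) (enum_val j))%:R) ->
  forall i j, (A *m B *m D) i j =
    (\sum_b (\sum_a fa (enum_val i) a * fb a b) * fd b (enum_val j))%N%:R.
Proof.
move=> hA hB hD i j; rewrite natr_sum -sum_att mxE; apply: eq_bigr => k _.
rewrite natrM -hD natr_sum -sum_att mxE; congr (_ * _); apply: eq_bigr => l _.
by rewrite natrM -hA -hB.
Qed.

Lemma cover_mx_uniform :
  t ^+ 2 *: (Rm *m Rm^T *m Rm^T) - (t ^+ 2 + 1) *: (Rm^T *m Rm *m Rm^T) + Rm^T *m Rm^T *m Rm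
  = - ((t ^+ 2 + 1) * att_gam ^+ 2) *: (Rm^T *m Smx att_deg t).
Proof.
have hR i j : Rm i j = (covers (enum_val i) (enum_val j))%:R by rewrite mxE.
pose covT (x y : X) := covers y x.
have hT i j : Rm^T i j = (covT (enum_val i) (enum_val j))%:R by rewrite !mxE.
apply/matrixP=> i j; set y : X := enum_val i; set z : X := enum_val j.
have E (a b : C) (M1 M2 M3 : 'M[C]_#|X|) :
  (a *: M1 - b *: M2 + M3) i j = a * M1 i j - b * M2 i j + M3 i j by rewrite !mxE.
rewrite E (mul_cover hR hT hT) (mul_cover hT hR hT) (mul_cover hT hT hR).
rewrite [RHS]mxE mul_mx_diag mxE hT mxE -/y -/z att_t2.
rewrite -/(RRtRt y z) -/(RtRRt y z) -/(RtRtR y z) -[covT y z]/(covers z y).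
have -> : att_gam ^+ 2 = q%:R ^+ (N + M) by rewrite /att_gam exprAC att_t2.
rewrite /att_deg -/z.
have [dz|dz] := eqVneq (\dim (val z)) (\dim (val y)).+1; last first.
  have [-> -> -> ->] := uniform_count0 dz.
  by rewrite !(mulr0, mul0r, subr0, addr0).
have := congr1 (fun m : nat => m%:R : C) (uniform_count dz).
have q0 : q%:R != 0 :> C by rewrite pnatr_eq0 -lt0n ltnW ?q_gt1.
have dN : (\dim (val z) <= N + M)%N by rewrite (leq_trans (dim_att_le z)) ?leq_addr.
(* [Smx] contributes the inverse of [q^(dim z)], which turns [q^(N+M)] into the power occurring in
   [uniform_count]. *)
have -> : q%:R ^+ (N + M) = q%:R ^+ (N + M - \dim (val z)) * q%:R ^+ \dim (val z) :> C.
  by rewrite -exprD subnK.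
rewrite -[q.+1]addn1 !(natrD, natrM) natrX => /eq_of_sub_eq; apply.
have nX := expf_neq0 (\dim (val z)) q0.
move: nX; move: (q%:R ^+ \dim (val z)) (q%:R ^+ (N + M - _)) => D P D0.
move: (q%:R) (RRtRt y z)%:R (RtRtR y z)%:R (RtRRt y z)%:R (covers z y)%:R => Q n1 n3 n2 c.
by field.
Qed.

(** Only entries of [w] below [z] reach the coordinate [z]; they are nonnegative, so a chain from
    [y] to [z] contributes without cancellation. Entries elsewhere may be negative, as in
    [lowest_height_pred]. *)
Lemma iter_cover_gt0 m (w : 'cV[C]_#|X|) y z :
  (forall i, (val (enum_val i : X) <= val z)%VS -> 0 <= w i 0) ->
  0 < w (enum_rank y) 0 -> (val y <= val z)%VS -> \dim (val z) = (\dim (val y) + m)%N ->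
  0 < iter m (mulmx Rm) w (enum_rank z) 0.
Proof.
elim: m w y => [|m IHm] w y w0 wy yz dz.
  rewrite /=; suff -> : z = y by [].
  by apply/esym/val_inj/eqP; rewrite eqEdim yz dz addn0 /=.
rewrite iterSr.
have [v vz vy] : exists2 v, v \in val z & v \notin val y.
  have [|] := boolP (val z <= val y)%VS; last by case/subvPn=> v; exists v.
  by move/dimvS; rewrite dz; lia.
have cz : (val y + <[v]> <= val z)%VS by rewrite subv_add yz -memvE.
pose c := mkatt y (val y + <[v]>)%VS.
have cE : val c = (val y + <[v]>)%VS by apply/mkattK/(@sub_att _ _ _ z).
have Rw i : (val (enum_val i : X) <= val z)%VS -> forall j, 0 <= Rm i j * w j 0.
  move=> iz j; rewrite mxE; case: (boolP (covers _ _)) => [/coversP[ji _]|_]; last by rewrite mul0r.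
  by rewrite mul1r w0 // (subv_trans ji).
apply: (IHm _ c); rewrite ?cE //.
- by move=> i iz; rewrite mxE sumr_ge0 // => j _; apply: Rw.
- rewrite mxE (bigD1 (enum_rank y)) //= ltr_wpDr //.
    by apply: sumr_ge0 => j _; apply: Rw; rewrite enum_rankK cE.
  rewrite mxE !enum_rankK (_ : covers c y) ?mul1r //.
  by apply/coversP; rewrite cE addvSl dim_addv_line.
- by rewrite dim_addv_line // dz addnS addSn.
Qed.

Lemma att0_subproof : ((0%VS : {vspace H}) :&: h)%VS == 0%VS.
Proof. by rewrite cap0v. Qed.

Definition att0 : X := exist _ 0%VS att0_subproof.
Definition att_top : X := mkatt att0 h^C%VS.

Lemma att_topE : val att_top = h^C%VS.
Proof. by apply: mkattK; rewrite capvC capv_compl. Qed.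

Lemma dim_att_top : \dim (val att_top) = N.
Proof. by rewrite att_topE dimv_compl dimH dimh addnK. Qed.

Lemma lower_cover (w : 'cV[C]_#|X|) i :
  (Rm^T *m w) i 0 = \sum_x (covers x (enum_val i))%:R * w (enum_rank x) 0.
Proof.
rewrite -sum_att mxE; apply: eq_bigr => j _.
by rewrite !mxE enum_valK.
Qed.

Lemma covers_line x b : \dim (val x) = 1%N -> covers x b = (\dim (val b) == 0%N).
Proof.
move=> dx; apply/coversP/eqP => [[_]|db]; first by rewrite dx => -[].
by rewrite dx db; move/eqP: db; rewrite dimv_eq0 => /eqP ->; rewrite sub0v.
Qed.

Definition att_delta y : 'cV[C]_#|X| := \col_i (enum_val i == y)%:R.

Lemma lower_delta y : Rm^T *m att_delta y = \col_i (covers y (enum_val i))%:R.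
Proof.
apply/colP=> i; rewrite lower_cover [RHS]mxE (bigD1 y) //= big1 => [|x /negPf xy].
  by rewrite mxE enum_rankK eqxx mulr1 addr0.
by rewrite mxE enum_rankK xy mulr0.
Qed.

Lemma lowest_height_N : exists w, lowest N att_deg Rm N w.
Proof.
exists (att_delta att0); split.
- move=> i; rewrite mxE /att_deg; have [->|_] := eqVneq (enum_val i) att0; last by rewrite eqxx.
  by rewrite dimv0 subnn.
- rewrite lower_delta; apply/colP=> i; rewrite !mxE.
  case: (boolP (covers _ _)) => [/coversP[_]|] //.
  by rewrite dimv0.
apply/negP=> /eqP/colP/(_ (enum_rank att_top)); rewrite mxE.
apply/eqP/lt0r_neq0/(iter_cover_gt0 _ (y := att0)).
- by move=> i _; rewrite mxE ler0n.
- by rewrite mxE enum_rankK eqxx ltr01.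
- by rewrite sub0v.
- by rewrite dim_att_top dimv0.
Qed.

(** Take two lines [<[a]>] and [<[a + l]>] with [a] in a complement of [h] and [l] in [h], both
    nonzero. Both lines cover only 0, so the difference of their indicators is killed by lowering;
    only the first lies below [att_top], where the raised vector is therefore positive. *)
Lemma lowest_height_pred (hN : (0 < N)%N) (hM : (0 < M)%N) :
  exists w, lowest N att_deg Rm N.-1 w.
Proof.
pose a := vpick (h^C)%VS; pose l := vpick h.
have a0 : a != 0 by rewrite vpick0 -dimv_eq0 -att_topE dim_att_top -lt0n.
have l0 : l != 0 by rewrite vpick0 -dimv_eq0 dimh -lt0n.
have aC : a \in (h^C)%VS := memv_pick _.
have lh : l \in h := memv_pick _.
have hC0 v : v \in h -> v \in (h^C)%VS -> v = 0.
  by move=> vh vC; apply/eqP; rewrite -memv0 -(capv_compl h) memv_cap vh.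
have alh : a + l \notin h.
  by apply: contra a0 => alh; apply/eqP/hC0 => //; rewrite -(addrK l a) memvB.
have line_cap v : v \notin h -> (<[v]> :&: h)%VS = 0%VS.
  move=> vh; apply/eqP; rewrite -subv0; apply/subvP=> _ /memv_capP[/vlineP[k ->] kvh].
  have [->|k0] := eqVneq k 0; first by rewrite scale0r mem0v.
  by case/negP: vh; rewrite -(scalerK k0 v) memvZ.
have ah : a \notin h by apply: contra a0 => ah; apply/eqP/hC0.
have dim1 v : v \notin h -> \dim <[v]> = 1%N.
  by move=> vh; rewrite dim_vline (_ : v != 0) //; apply: contraNneq vh => ->; rewrite mem0v.
have [y yE] : exists y : X, val y = <[a]>%VS.
  by exists (mkatt att0 <[a]>%VS); apply/mkattK/line_cap.
have [y' yE'] : exists y' : X, val y' = <[a + l]>%VS.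
  by exists (mkatt att0 <[a + l]>%VS); apply/mkattK/line_cap.
have y'top : ~~ (val y' <= val att_top)%VS.
  rewrite yE' att_topE -memvE; apply: contra l0 => alC.
  by apply/eqP/hC0 => //; rewrite -(addKr a l) addrC memvB.
pose w := att_delta y - att_delta y'.
exists w; split.
- move=> i; rewrite !mxE /att_deg -subn1 subKn // => wi.
  have [->|iy] := eqVneq (enum_val i) y; first by rewrite yE dim1.
  have [->|iy'] := eqVneq (enum_val i) y'; first by rewrite yE' dim1.
  by move: wi; rewrite (negPf iy) (negPf iy') subrr eqxx.
- apply: mulmx_sub_eq0.
  have ld x : \dim (val x) = 1%N ->
      Rm^T *m att_delta x = \col_i (\dim (val (enum_val i : X)) == 0%N)%:R.
    by move=> dx; rewrite lower_delta; apply/colP=> i; rewrite !mxE covers_line.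
  have dy : \dim (val y) = 1%N by rewrite yE dim1.
  have dy' : \dim (val y') = 1%N by rewrite yE' dim1.
  exact: etrans (ld y dy) (esym (ld y' dy')).
have ytop : (val y <= val att_top)%VS by rewrite yE att_topE -memvE.
apply/negP=> /eqP/colP/(_ (enum_rank att_top)); rewrite mxE.
apply/eqP/lt0r_neq0/(iter_cover_gt0 _ (y := y)) => //.
- move=> i it; rewrite !mxE (_ : _ == y' = false) ?subr0 ?ler0n //.
  by apply: contraNF y'top => /eqP <-.
- rewrite !mxE enum_rankK eqxx (_ : y == y' = false) ?subr0 ?ltr01 //.
  by apply: contraNF y'top => /eqP <-.
- by rewrite dim_att_top yE dim1 // add1n prednK.
Qed.

End CoverMatrix.

Theorem theorem10p5 (R : realType) (F : finFieldType) (H : vectType F)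
    (h : {vspace H}) (N M : nat) (hN : (0 < N)%N) (hM : (0 < M)%N)
    (dimH : \dim {: H} = (N + M)%N) (dimh : \dim h = M) :
  Q_polynomial (q_adj h R) (dual_alg h R N) (2 * N).
Proof.
have -> : q_adj h R = cover_mx R[i] h + Lmx (@att_deg F H h) (cover_mx R[i] h) (att_t R[i] F).
  apply/matrixP=> i j; rewrite 2!mxE LmxE !mxE att_t2 -natrX; lazy zeta.
  (* Two elements cannot cover each other, so the nested conditional of [q_adj] is the sum of the
     two entries. *)
  case: (boolP (covers (enum_val i) (enum_val j))) => [/coversP[_ e]|_].
    case: (boolP (covers _ _)) => [/coversP[_ e']|_]; last by rewrite mulr0n mulr0 addr0.
    by move/eqP: e'; rewrite e ltn_eqF // ltnS leqnSn.
  by rewrite add0r; case: (covers _ _); rewrite ?mulr0n ?mulr1 ?mulr0.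
apply: (@graded_Q_polynomial R[i] _ N (@att_deg F H h) (cover_mx R[i] h) (att_t R[i] F)
   (att_gam R[i] F N M)) => //.
- exact: att_t_gt1.
- exact: att_gam_neq0.
- by move=> i; apply: (dim_att_le dimH dimh).
- exact: cover_mx_deg.
- exact: cover_mx_real.
- exact: cover_mx_uniform.
- exact: (lowest_height_N _ dimH dimh).
- exact: (lowest_height_pred _ dimH dimh hN hM).
Qed.
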